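(* Let $1<p,q<\infty$ with $p\ne q$. (1) The Lorentz sequence space $\ell_{p,q}$ and the Lorentz function space $L_{p,q}[0,\infty)$ are not $UH^r$-smooth if $r>\min\{p,q\}$. (2) The Lorentz function space $L_{p,q}[0,1]$ is not $UH^r$-smooth if $r>q$.
   Context: All spaces are real. $\ell_{p,q}$ is the space of all sequences $(a_n)_{n=1}^\infty$ with $\|(a_n)\|_{p,q}=\left(\sum_{n=1}^\infty (a_n^* )^q\,(n^{q/p}-(n-1)^{q/p})\right)^{1/q}<\infty$, where $(a_n^* )$ is the decreasing rearrangement of $(|a_n|)$. For $I=[0,1]$ or $I=[0,\infty)$ with Lebesgue measure, $L_{p,q}(I)$ is the space of all measurable functions $f$ on $I$ with $\|f\|_{L_{p,q}}=\left(\int_I (f^*(t))^q\,d(t^{q/p})\right)^{1/q}<\infty$, where $f^*$ is the decreasing rearrangement of $|f|$. (When $q>p$ these functionals are quasi-norms equivalent to norms, and the spaces are considered with such an equivalent norm; the notion of smoothness below does not depend on the choice.) Smoothness: let $1<r<\infty$ and let $N$ be the greatest integer strictly less than $r$. A function $\phi:X\to\mathbb R$ on a Banach space $X$ is $UH^r$-smooth if it is $N$ times Fréchet differentiable and there is $C>0$ with $\|\phi^{(N)}(x)-\phi^{(N)}(y)\|\le C\|x-y\|^{r-N}$ for all $x,y\in X$. The space $X$ is $UH^r$-smooth if there is a $UH^r$-smooth function on $X$ with bounded nonempty support. *)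

(* Defs.v *)
From HB Require Import structures.
From mathcomp Require Import all_boot all_order all_algebra.
From mathcomp Require Import all_classical all_reals all_analysis.

Set Implicit Arguments.
Unset Strict Implicit.
Unset Printing Implicit Defensive.

Import Order.TTheory GRing.Theory Num.Theory.
Import numFieldNormedType.Exports.

Local Open Scope classical_set_scope.
Local Open Scope ring_scope.

Section BoundedOperators.
Context (R : realType) (X Y : normedModType R).

Definition blin_set : set (X -> Y) :=
  [set f | linear f /\ exists M : R, forall x, `|f x| <= M * `|x|].

Definition blin_pred : {pred X -> Y} := mem blin_set.

Lemma blin_submod_closed : submod_closed blin_pred.
Proof.
have E0 z : (0 : X -> Y) z = 0 by [].
split.
  apply/mem_set; split=> [a u v|]; first by rewrite !E0 scaler0 addr0.
  by exists 0 => x; rewrite E0 mul0r normr0.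
move=> a f g /set_mem[lf [Mf bf]] /set_mem[lg [Mg bg]].
apply/mem_set; split=> [b u v|].
  rewrite !addrfctE !scalrfctE lf lg.
  by rewrite !scalerDr !scalerA (mulrC a) addrACA.
exists (`|a| * Mf + Mg) => x.
apply: (le_trans (ler_normD _ _)).
by rewrite mulrDl lerD// normrZ -mulrA ler_wpM2l.
Qed.

HB.instance Definition _ :=
  GRing.isSubmodClosed.Build _ _ blin_pred blin_submod_closed.

Record blin := Blin { blin_fun :> X -> Y; _ : blin_fun \in blin_pred }.

HB.instance Definition _ := [isSub for blin_fun].
HB.instance Definition _ := gen_eqMixin blin.
HB.instance Definition _ := gen_choiceMixin blin.
HB.instance Definition _ := [SubChoice_isSubLmodule of blin by <:].

Definition opnorm (f : blin) : R := sup [set `|f x| | x in [set x | `|x| <= 1]].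

Lemma blinP (f : blin) : linear f /\ exists M : R, forall x, `|f x| <= M * `|x|.
Proof. by case: f => f /= /set_mem. Qed.

Lemma blin0 (f : blin) : f 0 = 0.
Proof.
have [lf _] := blinP f.
by have := lf (-1) 0 0; rewrite scaler0 addr0 scaleN1r addNr.
Qed.

Lemma blinZ (f : blin) a x : f (a *: x) = a *: f x.
Proof. by have [lf _] := blinP f; rewrite -[X in f X]addr0 lf blin0 addr0. Qed.

Lemma blin_has_sup (f : blin) :
  has_sup [set `|f x| | x in [set x | `|x| <= 1]].
Proof.
split; first by exists `|f 0|; exists 0 => //=; rewrite normr0.
have [_ [M bM]] := blinP f; exists `|M| => _ [x /= x1 <-].
apply: (le_trans (bM x)); apply: (le_trans (ler_norm _)).
by rewrite normrM normr_id ler_piMr.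
Qed.

Lemma opnorm_ub (f : blin) x : `|f x| <= opnorm f * `|x|.
Proof.
have [->|x0] := eqVneq x 0; first by rewrite blin0 !normr0 mulr0.
have nx : 0 < `|x| by rewrite normr_gt0.
rewrite -ler_pdivrMr//.
have -> : `|f x| / `|x| = `|f (`|x|^-1 *: x)|.
  by rewrite blinZ normrZ normfV normr_id mulrC.
apply: ub_le_sup; first by have [] := blin_has_sup f.
by exists (`|x|^-1 *: x) => //=; rewrite normrZ normfV normr_id mulVf ?gt_eqF.
Qed.

Lemma opnorm_le (f : blin) M :
  (forall x, `|x| <= 1 -> `|f x| <= M) -> opnorm f <= M.
Proof.
move=> fM; apply: ge_sup; first by have [] := blin_has_sup f.
by move=> _ [x /= x1 <-]; exact: fM.
Qed.

Lemma opnorm_ge0 (f : blin) : 0 <= opnorm f.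
Proof.
apply: ub_le_sup; first by have [] := blin_has_sup f.
by exists 0 => /=; rewrite ?blin0 normr0.
Qed.

Lemma opnorm_unit (f : blin) x : `|x| <= 1 -> `|f x| <= opnorm f.
Proof.
by move=> x1; rewrite (le_trans (opnorm_ub f x))// ler_piMr// opnorm_ge0.
Qed.

Lemma opnormD (f g : blin) : opnorm (f + g) <= opnorm f + opnorm g.
Proof.
apply: opnorm_le => x x1; apply: (le_trans (ler_normD _ _)).
by rewrite lerD ?opnorm_unit.
Qed.

Lemma opnormZ a (f : blin) : opnorm (a *: f) = `|a| * opnorm f.
Proof.
apply/eqP; rewrite eq_le; apply/andP; split.
  by apply: opnorm_le => x x1; rewrite /= normrZ ler_wpM2l ?opnorm_unit.
have [->|a0] := eqVneq a 0; first by rewrite normr0 mul0r opnorm_ge0.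
rewrite -ler_pdivlMl ?normr_gt0//; apply: opnorm_le => x x1.
rewrite ler_pdivlMl ?normr_gt0// -normrZ.
exact: (@opnorm_unit (a *: f)).
Qed.

Lemma opnorm_eq0 (f : blin) : opnorm f = 0 -> f = 0.
Proof.
move=> f0; apply/val_inj/funext => x /=.
by apply/eqP; rewrite -normr_le0 (le_trans (opnorm_ub f x))// f0 mul0r.
Qed.

HB.instance Definition _ :=
  Lmodule_isNormed.Build R blin opnormD opnormZ opnorm_eq0.

End BoundedOperators.

Section Smoothness.
Context (R : realType).

(* The Fréchet derivative as a map into the operator space; by [fderivE] it is
   ['d F x] when [F] is differentiable at [x], and the default 0 is never used
   under the hypotheses below. *)
Definition fderiv (X Y : normedModType R) (F : X -> Y) (x : X) : blin X Y :=
  insubd 0 ('d F x : X -> Y).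

Lemma fderivE (X Y : normedModType R) (F : X -> Y) (x : X) :
  differentiable F x -> fderiv F x = 'd F x :> (X -> Y).
Proof.
move=> dF; rewrite /fderiv val_insubd ifT//; apply/mem_set; split.
  by move=> a u v; exact: linearP.
have /linear_bounded_continuous/linear_boundedP/pinfty_ex_gt0[M _ bM] :=
  diff_continuous dF.
by exists M.
Qed.

(* L(X, L(X, ..., L(X, R))), i.e. the k-linear bounded forms on X with the
   usual norm. *)
Fixpoint forms (X : normedModType R) (k : nat) : normedModType R :=
  if k is k'.+1 then blin X (forms X k') else R^o.

Fixpoint nfderiv (X : normedModType R) (phi : X -> R) (k : nat) :
    X -> forms X k :=
  if k is k'.+1 then fderiv (nfderiv phi k') else phi.

Definition nfdifferentiable (X : normedModType R) (phi : X -> R) (n : nat) :=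
  forall k, (k < n)%N -> forall x, differentiable (nfderiv phi k) x.

Definition UH_smooth_fun (X : normedModType R) (r : R) (phi : X -> R) : Prop :=
  exists N : nat, [/\ N%:R < r <= N.+1%:R,
    nfdifferentiable phi N
  & exists2 C : R, 0 < C & forall x y,
      `|nfderiv phi N x - nfderiv phi N y| <= C * `|x - y| `^ (r - N%:R)].

Definition supp (X : normedModType R) (phi : X -> R) : set X :=
  closure [set x | phi x != 0].

Definition UH_smooth (X : normedModType R) (r : R) : Prop :=
  exists phi : X -> R,
    [/\ UH_smooth_fun r phi, bounded_set (supp phi) & supp phi !=set0].

End Smoothness.

Section Lorentz.
Context (R : realType).

(* The decreasing rearrangement of |f| on D:
   f^*(t) = inf {l >= 0 : mu {x in D : |f x| > l} <= t}. *)
Definition rearr (T : Type) (mu : set T -> \bar R) (D : set T) (f : T -> R)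
    (t : R) : \bar R :=
  ereal_inf [set l%:E | l in
    [set l : R | 0 <= l /\ (mu (D `&` [set x | (l < `|f x|)%R]) <= t%:E)%E]].

(* [rearr counting setT a n%:R] is the (n+1)-st term of the decreasing
   rearrangement of |a|, the indexing starting at n = 0. *)
Definition lorentz_seq_norm (p q : R) (a : nat -> R) : \bar R :=
  ((\sum_(0 <= n <oo)
      rearr counting [set: nat] a n%:R `^ q
      * (n.+1%:R `^ (q / p) - n%:R `^ (q / p))%R%:E) `^ q^-1)%E.

Definition lorentz_seq (p q : R) : set (nat -> R) :=
  [set a | (lorentz_seq_norm p q a < +oo)%E].

(* d(t^(q/p)) = (q/p) t^(q/p - 1) dt *)
Definition lorentz_fun_norm (p q : R) (I : set R) (f : R -> R) : \bar R :=
  ((\int[lebesgue_measure]_(t in I)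
      (rearr lebesgue_measure I f t `^ q
       * (q / p * t `^ (q / p - 1))%R%:E)) `^ q^-1)%E.

(* Functions on I are represented by total functions whose values off I are
   irrelevant. *)
Definition lorentz_fun (p q : R) (I : set R) : set (R -> R) :=
  [set f | measurable_fun I f /\ (lorentz_fun_norm p q I f < +oo)%E].

(* [X] is the space [S] of functions on [T], with functions at [N]-distance 0
   identified (for the Lorentz functionals: equality, resp. a.e. equality), under
   a norm equivalent to [N]; [J f] is the class of [f], and the values of [J] off
   [S] are irrelevant. For [q > p] the functional is only a quasi-norm, so a
   norm has to be chosen; every choice is allowed. *)
Definition renorming_of (T : Type) (S : set (T -> R)) (N : (T -> R) -> \bar R)
    (X : normedModType R) : Prop :=
  exists J : (T -> R) -> X,
    [/\ forall (a : R) (f g : T -> R), S f -> S g ->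
          J (fun t => a * f t + g t) = a *: J f + J g,
        forall x : X, exists2 f, S f & J f = x
      & exists c C : R, [/\ 0 < c, 0 < C & forall f, S f ->
          (c%:E * N f <= `|J f|%:E)%E /\ (`|J f|%:E <= C%:E * N f)%E]].

Definition is_lorentz_seq_space (p q : R) (X : normedModType R) : Prop :=
  renorming_of (lorentz_seq p q) (lorentz_seq_norm p q) X.

Definition is_lorentz_fun_space (p q : R) (I : set R) (X : normedModType R) :
    Prop :=
  renorming_of (lorentz_fun p q I) (lorentz_fun_norm p q I) X.

End Lorentz.

(* Main.v *)
(** Let [m = min p q] and let [phi] be a [UH^r] bump, [r > m].  All
three spaces contain, uniformly, the finite-dimensional spaces [l_{p,q}^D].  In
these, a bounded homogeneous polynomial of degree [k <= m] is small on all but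
boundedly many members of a large family of disjoint translates of one vector:
otherwise its value on suitable sums of the family would exceed its bound,
because [p <> q] prevents [\sum x_i ^ k], [k <= m], from being bounded on
[l_{p,q}].  Hence, by Taylor's formula, from any point [x] of the support some
translate [u] in the family satisfies [phi (x + s u) = phi x + O(s ^ e)] with
[m < e <= r].  After [n] such steps [phi] has changed by [O(n s ^ e)], while the
sum of the steps has norm at least [c s n ^ (1 / m)]: for [p < q] add unit
coordinate vectors, for [q < p] normalized indicators of blocks of
geometrically growing sizes, which satisfy a lower [l_q]-estimate.  With
[s ~ n ^ (- 1 / m)] and [n] large, this leaves the support of [phi] while [phi]
stays away from [0]. *)
Require Import Defs.
From HB Require Import structures.
From mathcomp Require Import all_boot all_order all_algebra.
From mathcomp Require Import all_classical all_reals all_analysis.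
From mathcomp Require Import measurable_realfun finmap ring lra zify.

Set Implicit Arguments.
Unset Strict Implicit.
Unset Printing Implicit Defensive.

Import Order.TTheory GRing.Theory Num.Theory.
Import numFieldNormedType.Exports.

Local Open Scope classical_set_scope.
Local Open Scope ring_scope.

(** * Iterated derivatives along lines *)

Section DiagonalForms.
Context (R : realType) (X : normedModType R).

(** The homogeneous polynomial of a curried [k]-linear form. Derivatives enter the proof only
    through these polynomials and their restrictions to lines. *)
Fixpoint diag (k : nat) : forms X k -> X -> R :=
  if k is k'.+1 then fun A h => diag (A h) h else fun A _ => A.

Lemma diag_linear k h : linear ((fun A : forms X k => diag A h) : forms X k -> R^o).
Proof.
elim: k => [//|k IH] a A B /=.
exact: IH.
Qed.

Lemma diag_bound k (A : forms X k) h : `|diag A h| <= `|A| * `|h| ^+ k.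
Proof.
elim: k A => [|k IH] A /=; first by rewrite expr0 mulr1.
apply: (le_trans (IH _)).
by rewrite exprS mulrA ler_wpM2r ?exprn_ge0// opnorm_ub.
Qed.

Lemma diag_homog k (A : forms X k) a h : diag A (a *: h) = a ^+ k * diag A h.
Proof.
have dZ j (B : forms X j) (b : R) y : diag (b *: B) y = b * diag B y.
  have := diag_linear y b B 0; rewrite addr0 => ->.
  have := diag_linear y (-1) (0 : forms X j) 0.
  by rewrite scaler0 addr0 scaleN1r addNr => ->; rewrite addr0.
elim: k A => [|k IH] A /=; first by rewrite expr0 mul1r.
by rewrite blinZ dZ IH exprS mulrA.
Qed.

(** Splitting the first argument, [A (x + t h) = A x + t A h], gives a polynomial [p1 + 'X * p2]
    from the two forms of lower degree. *)
Lemma diag_lines k (A : forms X k) x h :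
  exists p : {poly R}, (size p <= k.+1)%N /\ forall t, diag A (x + t *: h) = p.[t].
Proof.
elim: k A => [|k IH] A /=.
  by exists (A%:P); split=> [|t]; [exact: size_polyC_leq1|rewrite hornerC].
have [p1 [s1 e1]] := IH (A x); have [p2 [s2 e2]] := IH (A h).
exists (p1 + 'X * p2); split.
  apply: (leq_trans (size_polyD _ _)); rewrite geq_max (leq_trans s1)//=.
  rewrite mulrC; have [->|p20] := eqVneq p2 0; first by rewrite mul0r size_poly0.
  by rewrite size_mulX.
move=> t; rewrite hornerD hornerM hornerX -e1 -e2.
have -> : A (x + t *: h) = t *: A h + A x.
  by have [lA _] := blinP A; rewrite addrC lA.
by rewrite diag_linear addrC.
Qed.

Lemma diag_continuous k h :
  continuous ((fun A : forms X k => diag A h) : forms X k -> R^o).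
Proof.
have bl : \forall r \near +oo, forall A : forms X k, `|diag A h : R^o| <= r * `|A|.
  exists (`|h| ^+ k); split; first exact: num_real.
  move=> r hr A; rewrite (le_trans (diag_bound A h))// mulrC ler_wpM2r//.
  exact: ltW.
pose f : {linear forms X k -> R^o} := HB.pack (fun A : forms X k => diag A h : R^o)
  (GRing.isLinear.Build R (forms X k) R^o *:%R _ (@diag_linear k h)).
suff: continuous f by [].
apply: bounded_linear_continuous; apply/linear_boundedP.
exact: bl.
Qed.

(** Chain rule for the affine line, the [k]-th derivative and the bounded linear evaluation
    [A |-> diag A h]. Iterating it yields all derivatives of [phi] along a line. *)
Lemma is_derive_diag_nfderiv (phi : X -> R) k x h (t : R) :
  differentiable (nfderiv phi k) (x + t *: h) ->
  is_derive (t : R^o) (1 : R^o)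
    (fun t : R^o => diag (nfderiv phi k (x + t *: h)) h : R^o)
    (diag (nfderiv phi k.+1 (x + t *: h)) h).
Proof.
move=> dF.
set l := fun t : R^o => x + t *: h.
pose L : forms X k -> R^o := fun A => diag A h.
pose f : {linear forms X k -> R^o} := HB.pack L
  (GRing.isLinear.Build R (forms X k) R^o *:%R _ (@diag_linear k h)).
have cf : continuous f := @diag_continuous k h.
have [dl dlE] : is_diff (t : R^o) l (0 + *:%R^~ h) by exact: is_diffD.
have dFl : differentiable (nfderiv phi k \o l) t by exact: differentiable_comp.
have dL : differentiable f ((nfderiv phi k \o l) t) by exact: linear_differentiable.
set F := f \o (nfderiv phi k \o l).
have dfull : differentiable F t by exact: differentiable_comp.
suff : is_derive (t : R^o) (1 : R^o) F (diag (nfderiv phi k.+1 (x + t *: h)) h) by [].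
apply: DeriveDef; first exact: diff_derivable.
rewrite deriveE// diff_comp// (diff_lin _ cf) diff_comp// dlE add0r [LHS]/= scale1r.
by rewrite /L [RHS]/= fderivE.
Qed.

End DiagonalForms.

Lemma is_derive_horner (R : realType) (p : {poly R}) (x : R) :
  is_derive (x : R^o) (1 : R^o) (horner p : R^o -> R^o) (p^`()).[x].
Proof.
apply: DeriveDef; first exact: derivable_horner.
by rewrite -derive1E -derivE.
Qed.

(** The difference of [g 0] and its Taylor polynomial vanishes at 0, and its derivative is the same
    difference for the shifted sequence; the mean value theorem on [[0, t]] with [t <= 1] closes the
    induction. The sum includes degree [N], so only the oscillation of [g N] is needed. *)
Lemma taylor_remainder (R : realType) (N : nat) (g : nat -> R -> R) (M : R) :
  (forall k t, (k < N)%N -> is_derive (t : R^o) (1 : R^o) (g k : R^o -> R^o) (g k.+1 t)) ->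
  (forall t, 0 <= t <= 1 -> `|g N t - g N 0| <= M) ->
  forall t, 0 <= t <= 1 -> `|g 0 t - (\poly_(k < N.+1) (g k 0 / k`!%:R)).[t]| <= M.
Proof.
elim: N g => [|N IH] g dg gM t t01.
  by rewrite horner_poly big_ord1 fact0 divr1 expr0 mulr1 gM.
have {}IH := IH (fun k => g k.+1) (fun k t kN => dg k.+1 t kN) gM.
set p := \poly_(k < N.+2) _.
have dp : p^`() = \poly_(k < N.+1) (g k.+1 0 / k`!%:R).
  apply/polyP => k; rewrite coef_deriv !coef_poly ltnS.
  case: ifP => _; last by rewrite mul0rn.
  rewrite -[LHS]mulr_natr factS natrM invfM -!mulrA; congr (_ * _).
  by rewrite mulrCA mulVf ?mulr1// pnatr_eq0.
pose G := (g 0 : R^o -> R^o) - (horner p : R^o -> R^o).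
have dG (u : R) : is_derive (u : R^o) (1 : R^o) G (g 1 u - (p^`()).[u]).
  by have ? := dg 0%N u isT; have ? := is_derive_horner p u; exact: is_deriveB.
have G0 : G 0 = 0.
  have -> : G 0 = g 0%N 0 - p.[0] by [].
  rewrite /p horner_poly big_ord_recl /= fact0 divr1 expr0 mulr1 big1 ?addr0 ?subrr//.
  by move=> i _; rewrite exprS mul0r mulr0.
have [t0 t1] := andP t01.
have [|c c01] := @MVT_segment R G (fun u => g 1 u - (p^`()).[u]) 0 t t0 (fun x _ => dG x).
  apply: continuous_subspaceT => u.
  by apply: differentiable_continuous; apply/derivable1_diffP; have [] := dG u.
rewrite G0 !subr0 => Gt.
rewrite -[_ - _]/(G t) Gt normrM (ger0_norm t0).
have /IH : 0 <= c <= 1.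
  by move: c01; rewrite in_itv/= => /andP[-> /le_trans->].
rewrite -dp => Mc.
apply: (le_trans _ Mc).
by rewrite ler_piMr.
Qed.

(** * Homogeneous polynomials on large families *)

Section PolynomialsOnLines.
Context (R : realType).

(** Interpolation at the nodes [0, ..., D]: the inverse Vandermonde matrix recovers coefficients
    from values. Indices are plain naturals, hence [inord]. *)
Definition lagr (D : nat) (i j : nat) : R :=
  invmx (Vandermonde D.+1 (\row_(k < D.+1) k%:R)) (inord j) (inord i).

Lemma lagrE D (p : {poly R}) i : (size p <= D.+1)%N -> (i <= D)%N ->
  p`_i = \sum_(j < D.+1) lagr D i j * p.[j%:R].
Proof.
move=> sp iD.
pose V := Vandermonde D.+1 (\row_(k < D.+1) (k%:R : R)).
pose c : 'rV[R]_D.+1 := \row_k p`_k.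
have Vu : V \in unitmx.
  rewrite unitmxE det_Vandermonde unitfE.
  apply/prodf_neq0 => a _; apply/prodf_neq0 => b ab.
  by rewrite !mxE subr_eq0 eqr_nat gtn_eqF.
have cV : c *m V = \row_j p.[j%:R].
  apply/rowP => j; rewrite !mxE (horner_coef_wide _ sp).
  by apply: eq_bigr => k _; rewrite !mxE.
have /(congr1 (fun A : 'rV_D.+1 => A 0 (inord i))) : c = (\row_j p.[j%:R]) *m invmx V.
  by rewrite -cV mulmxK.
rewrite !mxE inordK// => ->; apply: eq_bigr => j _.
by rewrite mxE mulrC /lagr inord_val.
Qed.

Context (X : normedModType R).

Definition line_poly (D : nat) (G : X -> R) := forall x h,
  exists p : {poly R}, (size p <= D.+1)%N /\ forall t, G (x + t *: h) = p.[t].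

Definition homogeneous (l : nat) (G : X -> R) :=
  forall a h, G (a *: h) = a ^+ l * G h.

(** The coefficient of [t ^ i] in [G (x + t u)], written as a fixed combination of values of [G]:
    bounds and polynomial dependence on [u] are then inherited from [G]. *)
Definition line_coef (D i : nat) (G : X -> R) (x u : X) : R :=
  \sum_(j < D.+1) lagr D i j * G (x + j%:R *: u).

Lemma line_coefE D G x u i (p : {poly R}) : (size p <= D.+1)%N ->
  (forall t, G (x + t *: u) = p.[t]) -> (i <= D)%N -> line_coef D i G x u = p`_i.
Proof.
by move=> sp Gp iD; rewrite (lagrE sp iD); apply: eq_bigr => j _; rewrite Gp.
Qed.

Lemma line_coef_bound D : exists2 L : R, 0 <= L &
  forall i G x u B, (i <= D)%N -> 0 <= B ->
    (forall j, (j <= D)%N -> `|G (x + j%:R *: u)| <= B) ->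
    `|line_coef D i G x u| <= L * B.
Proof.
exists (\sum_(i < D.+1) \sum_(j < D.+1) `|lagr D i j|).
  by apply: sumr_ge0 => i _; apply: sumr_ge0.
move=> i G x u B iD B0 GB.
apply: (le_trans (ler_norm_sum _ _ _)).
apply: (@le_trans _ _ ((\sum_(j < D.+1) `|lagr D i j|) * B)).
  rewrite mulr_suml; apply: ler_sum => j _.
  by rewrite normrM ler_wpM2l// GB// -ltnS.
rewrite ler_wpM2r//.
rewrite [leRHS](bigD1 (Ordinal (iD : i < D.+1)%N))//= lerDl.
by apply: sumr_ge0 => k _; apply: sumr_ge0.
Qed.

Lemma line_polyN D G : line_poly D G -> line_poly D (fun u => - G u).
Proof.
move=> GD x h; have [p [sp Gp]] := GD x h.
by exists (- p); split=> [|t]; [rewrite size_polyN|rewrite hornerN Gp].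
Qed.

Lemma line_poly_coef D i G x : line_poly D G -> line_poly D (line_coef D i G x).
Proof.
move=> GD y h.
have /cid2/= : exists2 f : 'I_D.+1 -> {poly R}, (forall j, (size (f j) <= D.+1)%N) &
    forall (j : 'I_D.+1) t, G ((x + j%:R *: y) + t *: (j%:R *: h)) = (f j).[t].
  have H (j : 'I_D.+1) := cid (GD (x + j%:R *: y) (j%:R *: h)).
  by exists (fun j => sval (H j)) => j; case: (H j) => f /= [].
move=> [f sf fE].
exists (\sum_(j < D.+1) lagr D i j *: f j); split.
  apply: (leq_trans (size_sum _ _ _)); apply/bigmax_leqP => j _.
  exact: (leq_trans (size_scale_leq _ _)).
move=> t; rewrite horner_sum; apply: eq_bigr => j _.
by rewrite hornerZ -fE scalerDr addrA !scalerA (mulrC t).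
Qed.

Lemma homogeneous_coef D i G x : line_poly D G -> (i <= D)%N ->
  homogeneous i (line_coef D i G x).
Proof.
move=> GD iD a u; have [p [sp Gp]] := GD x u.
rewrite (line_coefE sp Gp iD).
rewrite (@line_coefE _ _ _ _ _ (\poly_(k < D.+1) (a ^+ k * p`_k)))//.
- by rewrite coef_poly ltnS iD.
- move=> t; rewrite scalerA Gp (horner_coef_wide _ sp) horner_poly.
  by apply: eq_bigr => k _; rewrite exprMn; ring.
Qed.

(** Infinitely many points of agreement suffice. They are taken nonzero so that identities involving
    [1 / t] can be tested on them. *)
Lemma eq_poly_horner (p q : {poly R}) : (forall n : nat, p.[n.+1%:R] = q.[n.+1%:R]) -> p = q.
Proof.
move=> pq; apply/eqP; rewrite -subr_eq0; apply/eqP.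
apply: (@roots_geq_poly_eq0 _ _ [seq i.+1%:R | i <- iota 0 (size (p - q))]).
- by apply/allP => _ /mapP[i _ ->]; rewrite rootE hornerD hornerN pq subrr.
- rewrite map_inj_uniq ?iota_uniq// => i j /eqP.
  by rewrite eqr_nat eqSS => /eqP.
- by rewrite size_map size_iota.
Qed.

(* Comparing [t |-> G (x + t u)] with [t |-> t ^ l * G (u + x / t)] shows that
   the former has degree at most [l] and leading coefficient [G u]. *)
Lemma homogeneous_expand D l G x u t : line_poly D G -> homogeneous l G ->
  (0 < l <= D)%N ->
  G (x + t *: u) = G x + \sum_(1 <= i < l) t ^+ i * line_coef D i G x u + t ^+ l * G u.
Proof.
move=> GD Gl /andP[l0 lD].
have [p [sp Gp]] := GD x u; have [q [sq Gq]] := GD u x.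
(* The second factor on the right is the reversal [t ^ D * q (1 / t)]. *)
have e : 'X^D * p = 'X^l * \poly_(k < D.+1) q`_(D - k).
  apply: eq_poly_horner => n; set c : R := n.+1%:R.
  have c0 : c != 0 by rewrite pnatr_eq0.
  rewrite !hornerM !hornerXn -Gp.
  have -> : x + c *: u = c *: (u + c^-1 *: x).
    by rewrite scalerDr scalerA divff// scale1r addrC.
  rewrite Gl Gq mulrCA; congr (_ * _).
  rewrite horner_poly (horner_coef_wide _ sq) mulr_sumr (reindex_inj rev_ord_inj)/=.
  apply: eq_bigr => k _; rewrite subSS mulrCA; congr (_ * _).
  have kD : (k <= D)%N by rewrite -ltnS.
  apply: (mulIf (expf_neq0 (D - k) c0)).
  by rewrite exprVn -mulrA mulVf ?expf_neq0// mulr1 -exprD subnKC.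
(* Compare the coefficients of degree [D + i] in [e]. *)
have coefp i : p`_i = if (i <= l)%N then q`_(l - i) else 0.
  have := congr1 (fun r : {poly R} => r`_(D + i)) e.
  rewrite !coefXnM ltnNge leq_addr/= addKn => ->.
  have -> : (D + i < l)%N = false by apply/negbTE; rewrite -leqNgt (leq_trans lD)// leq_addr.
  rewrite coef_poly; case: (leqP i l) => il.
    rewrite ifT; last by lia.
    by have -> : (D - (D + i - l) = l - i)%N by lia.
  by rewrite ifF//; lia.
have p0 : p`_0 = G x by rewrite -horner_coef0 -Gp scale0r addr0.
have pl : p`_l = G u by rewrite coefp leqnn subnn -horner_coef0 -Gq scale0r addr0.
rewrite Gp (horner_coef_wide _ sp) -(big_mkord xpredT (fun i => p`_i * t ^+ i)).
rewrite (big_cat_nat _ (n := l.+1))//= [X in _ + X]big1_seq ?addr0; last first.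
  move=> i; rewrite mem_index_iota => /andP[_ /andP[li _]].
  by rewrite coefp leqNgt li mul0r.
rewrite big_nat_recr//= big_ltn// expr0 mulr1 p0 pl [G u * _]mulrC; congr (_ + _ + _).
rewrite !big_nat; apply: eq_bigr => i /andP[i1 il].
by rewrite mulrC (line_coefE sp Gp)//; lia.
Qed.

End PolynomialsOnLines.

(** Union bound: if each entry of [T] satisfied some [P i], the counts would add up to at least
    [size T]. *)
Lemma exists_avoiding (T : seq nat) (P : nat -> pred nat) (n : nat -> nat) (l : nat) :
  (forall i, (i < l)%N -> (count (P i) T <= n i)%N) -> (\sum_(i < l) n i < size T)%N ->
  exists2 j, j \in T & forall i, (i < l)%N -> ~~ P i j.
Proof.
move=> Pn nT.
have [[j jT /forallP jP]|] := pselect (exists2 j, j \in T & [forall i : 'I_l, ~~ P i j]).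
  exists j => // i il; exact: (jP (Ordinal il)).
move=> noj; exfalso.
move: nT; rewrite ltnNge => /negP; apply.
apply: (@leq_trans (\sum_(i < l) \sum_(j <- T) P i j)%N); last first.
  by apply: leq_sum => i _; rewrite (leq_trans _ (Pn i _))// -sumn_count sumnE big_map.
rewrite exchange_big/= -sum1_size big_seq [leqRHS]big_seq; apply: leq_sum => j jT.
have /existsP[i Pij] : [exists i : 'I_l, P i j].
  have [//|/existsPn h] := boolP [exists i : 'I_l, P i j].
  by exfalso; apply: noj; exists j => //; apply/forallP.
by rewrite (bigD1 i)//= Pij.
Qed.

Section SmallnessOnFamilies.
Context (R : realType) (X : normedModType R).

(** Weights follow the order of selection, not the index: a greedy argument knows the weight of its
    [k]-th vector before choosing that vector. *)
Definition upper_family (t beta : nat -> R) (u : nat -> X) (S : seq nat) :=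
  forall s, uniq s -> {subset s <= S} ->
    `|\sum_(k < size s) t k *: u (nth 0%N s k)| <= beta (size s).

Lemma upper_family_sub t beta u S S' :
  {subset S' <= S} -> upper_family t beta u S -> upper_family t beta u S'.
Proof. by move=> sub uf s us sS; apply: uf => // j /sS /sub. Qed.

Lemma homogeneous_bound l (G : X -> R) K : homogeneous l G ->
  (forall y, `|y| <= 1 -> `|G y| <= K) -> forall y, `|G y| <= K * `|y| ^+ l.
Proof.
move=> Gl GK y; have [->|y0] := eqVneq y 0.
  rewrite -(scale0r 0) Gl normrM normrX scale0r !normr0 mulrC.
  by rewrite ler_wpM2r ?exprn_ge0// GK// normr0.
have ny : 0 < `|y| by rewrite normr_gt0.
have {1}-> : y = `|y| *: (`|y|^-1 *: y) by rewrite scalerA divff ?scale1r ?gt_eqF.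
rewrite Gl normrM normrX normr_id mulrC ler_wpM2r ?exprn_ge0// GK//.
by rewrite normrZ normfV normr_id mulVf ?gt_eqF.
Qed.

(* If [G > eps] on a large family, add members one at a time, always picking one
   on which the mixed terms of lower degree are negligible: [G] of the sum then
   grows like [\sum t_k ^ l], against the bound [K * beta ^ l]. *)
Lemma few_large_values (D m : nat) (t beta : nat -> R) :
  (m <= D)%N -> (forall k, 0 < t k <= 1) -> (forall n, 0 <= beta n) ->
  (forall (l : nat) (a b : R), (0 < l <= m)%N -> 0 < a -> 0 <= b ->
     exists n, b * beta n ^+ l < a * \sum_(k < n) t k ^+ l) ->
  forall (l : nat) (K eps : R), (0 < l <= m)%N -> 0 <= K -> 0 < eps ->
  exists n0, forall (G : X -> R) (u : nat -> X) (S : seq nat),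
    line_poly D G -> homogeneous l G -> (forall y, `|y| <= 1 -> `|G y| <= K) ->
    uniq S -> (forall j, j \in S -> `|u j| <= 1) -> upper_family t beta u S ->
    (count (fun j => (eps < G (u j))%R) S <= n0)%N.
Proof.
move=> mD t01 beta0 key l; elim/ltn_ind: l => l IH K eps /andP[l0 lm] K0 eps0.
have eps20 : 0 < eps / 2 by rewrite divr_gt0.
(* [n] selected members will already contradict the bound on [G], even after half of [eps] is given
   away to the mixed terms. *)
have [|n keyn] := key l (eps / 2) K _ eps20 K0; first by rewrite l0.
set sig := \sum_(k < n) t k ^+ l in keyn.
have sig0 : 0 < eps / 2 * sig by apply: le_lt_trans keyn; rewrite mulr_ge0// exprn_ge0.
have [L L0 Lb] := line_coef_bound X D.
(* Each of the [n] steps loses at most [l * eps'] in mixed terms, hence at most [eps / 2 * sig]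
   altogether. *)
pose eps' := eps / 2 * sig / (n * l).+1%:R.
have eps'0 : 0 < eps' by rewrite divr_gt0.
(* A bound on the unit ball for the mixed coefficients: the partial sums have norm at most [n], and
   interpolation moves at most [D] further. *)
pose K' := L * (K * (n + D)%:R ^+ l).
have K'0 : 0 <= K' by rewrite !mulr_ge0// exprn_ge0.
have /choice[f fP] : forall i, exists n0, (0 < i < l)%N ->
    forall (G : X -> R) (u : nat -> X) (S : seq nat),
    line_poly D G -> homogeneous i G -> (forall y, `|y| <= 1 -> `|G y| <= K') ->
    uniq S -> (forall j, j \in S -> `|u j| <= 1) -> upper_family t beta u S ->
    (count (fun j => (eps' < G (u j))%R) S <= n0)%N.
  move=> i; have [/andP[i0 il]|_] := boolP (0 < i < l)%N; last by exists 0%N.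
  have [|n0 n0P] := IH i il K' eps' _ K'0 eps'0; last by exists n0.
  by rewrite i0 (leq_trans (ltnW il)).
exists (n + \sum_(i < l) f i)%N => G u S0 GD Gl GK uS0 uS0n uf0.
rewrite leqNgt -size_filter; apply/negP.
set S := [seq j <- S0 | eps < G (u j)] => bigS.
have SS0 : {subset S <= S0} by move=> j; rewrite mem_filter => /andP[].
have uS : uniq S by rewrite filter_uniq.
have Sn j : j \in S -> `|u j| <= 1 by move=> /SS0 /uS0n.
have Seps j : j \in S -> eps < G (u j) by rewrite mem_filter => /andP[].
have {uf0} uf := upper_family_sub SS0 uf0.
pose x s := \sum_(k < size s) t k *: u (nth 0%N s k).
have Gb := homogeneous_bound Gl GK.
have greedy k : (k <= n)%N -> exists s, [/\ uniq s, {subset s <= S}, size s = k &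
    eps * \sum_(i < k) t i ^+ l - k%:R * (l%:R * eps') <= G (x s)].
  elim: k => [_|k IHk kn].
    exists [::]; split=> //; rewrite /x !big_ord0 mulr0 mul0r subr0.
    by rewrite -[X in G X](scale0r 0) Gl expr0n gtn_eqF// mul0r.
  have [s [us sS sk Gs]] := IHk (ltnW kn).
  have xn : `|x s| <= n%:R.
    apply: (le_trans (ler_norm_sum _ _ _)).
    apply: (@le_trans _ _ (\sum_(i < size s) 1)); last first.
      by rewrite sumr_const card_ord ler_nat sk ltnW.
    apply: ler_sum => i _; rewrite normrZ -[leRHS]mulr1.
    have /andP[ti0 ti1] := t01 i.
    by rewrite ler_pM// ?ger0_norm ?(ltW ti0)// Sn// sS// mem_nth.
  pose T := [seq j <- S | j \notin s].
  have TS : {subset T <= S} by move=> j; rewrite mem_filter => /andP[].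
  have sT : (\sum_(i < l) f i < size T)%N.
    have : (size S <= size s + size T)%N.
      rewrite -size_cat; apply: uniq_leq_size => // j jS.
      by rewrite mem_cat mem_filter jS andbT; case: (j \in s).
    rewrite sk -(ltn_add2l k) => h; apply: (leq_trans _ h).
    by apply: (leq_ltn_trans _ bigS); rewrite leq_add2r ltnW.
  (* Only very negative mixed coefficients do harm, so the induction hypothesis is applied to the
     opposite of [line_coef], of degree [i < l]. *)
  pose P i j := (0 < i)%N && (eps' < - line_coef D i G (x s) (u j)).
  have [i il|j jT jP] := @exists_avoiding T P f l _ sT.
    have [i0|i0] := posnP i.
      by rewrite (@eq_count _ _ pred0) ?count_pred0// => j; rewrite /P i0.
    rewrite (@eq_count _ _ (fun j => eps' < - line_coef D i G (x s) (u j))); last first.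
      by move=> j; rewrite /P i0.
    apply: (fP i _ (fun y => - line_coef D i G (x s) y)) => //.
    - by rewrite i0.
    - exact/line_polyN/line_poly_coef.
    - move=> a h; rewrite homogeneous_coef ?mulrN//.
      by rewrite (leq_trans (ltnW il))// (leq_trans lm).
    - move=> y y1; rewrite normrN; apply: Lb.
      + by rewrite (leq_trans (ltnW il))// (leq_trans lm).
      + by rewrite mulr_ge0// exprn_ge0.
      + move=> j jD; apply: (le_trans (Gb _)); rewrite ler_wpM2l// lerXn2r ?nnegrE//.
        apply: (le_trans (ler_normD _ _)); rewrite natrD lerD// normrZ normr_nat.
        by rewrite -[leRHS]mulr1 ler_pM// ler_nat.
    - by rewrite filter_uniq.
    - by move=> j /TS /Sn.
    - exact: upper_family_sub TS uf.
  have jS := TS _ jT.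
  exists (rcons s j); split.
  - by rewrite rcons_uniq us andbT; move: jT; rewrite mem_filter => /andP[].
  - by move=> i; rewrite mem_rcons inE => /predU1P[->//|/sS].
  - by rewrite size_rcons sk.
  have -> : x (rcons s j) = x s + t k *: u j.
    rewrite /x size_rcons big_ord_recr/= nth_rcons ltnn eqxx sk; congr (_ + _).
    by apply: eq_bigr => i _; rewrite nth_rcons sk ltn_ord.
  have /andP[tk0 tk1] := t01 k.
  rewrite (homogeneous_expand _ _ _ GD Gl) ?l0 ?(leq_trans lm)//.
  have lower : - (l%:R * eps') <= \sum_(1 <= i < l) t k ^+ i * line_coef D i G (x s) (u j).
    apply: (@le_trans _ _ (\sum_(1 <= i < l) - eps')).
      rewrite sumr_const_nat mulNrn lerN2 -[leLHS]mulr_natl.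
      by rewrite ler_wpM2r ?(ltW eps'0)// ler_nat leq_subr.
    rewrite !big_nat; apply: ler_sum => i /andP[i1 il].
    have := jP i il; rewrite /P i1/= -leNgt lerNl => ci.
    apply: (@le_trans _ _ (t k ^+ i * - eps')); last by rewrite ler_wpM2l// exprn_ge0// ltW.
    by rewrite mulrN lerN2 ler_piMl ?(ltW eps'0)// exprn_ile1// ltW.
  rewrite big_ord_recr/= mulrDr.
  have := Seps j jS => eGj.
  have : eps * t k ^+ l <= t k ^+ l * G (u j).
    by rewrite mulrC ler_wpM2l ?exprn_ge0 ?(ltW tk0) ?(ltW eGj).
  rewrite -addn1 natrD mulrDl mul1r.
  lra.
have [s [us sS sn]] := greedy n (leqnn n).
have := uf s us sS; rewrite -/(x s) sn => xb.
have := le_trans (ler_norm _) (Gb (x s)) => Gx.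
have : K * `|x s| ^+ l <= K * beta n ^+ l by rewrite ler_wpM2l// lerXn2r ?nnegrE.
have : n%:R * (l%:R * eps') <= eps / 2 * sig.
  rewrite mulrA -natrM /eps' mulrCA ler_piMr ?(ltW sig0)//.
  by rewrite ler_pdivrMr// mul1r ler_nat.
rewrite -/sig; lra.
Qed.

End SmallnessOnFamilies.

(** * Smooth bumps *)

Section GreedySteps.
Context (R : realType) (X : normedModType R).

Definition taylor_term (phi : X -> R) (x : X) (k : nat) (h : X) : R :=
  diag (nfderiv phi k x) h / k`!%:R.

Lemma taylor_term0 phi x h : taylor_term phi x 0 h = phi x.
Proof. by rewrite /taylor_term fact0 divr1. Qed.

Lemma taylor_term_homog phi x k : homogeneous k (taylor_term phi x k).
Proof. by move=> a h; rewrite /taylor_term diag_homog mulrA. Qed.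

Lemma taylor_term_lines phi x k D : (k <= D)%N -> line_poly D (taylor_term phi x k).
Proof.
move=> kD y h; have [p [sp pE]] := diag_lines (nfderiv phi k x) y h.
exists (k`!%:R^-1 *: p); split=> [|t].
  by rewrite (leq_trans (size_scale_leq _ _))// (leq_trans sp).
by rewrite hornerZ -pE mulrC.
Qed.

Section HolderTaylor.
Context (phi : X -> R) (N : nat) (r C : R).
Hypotheses (Nr : N%:R < r) (C0 : 0 < C) (dphi : nfdifferentiable phi N).
Hypothesis hphi : forall x y,
  `|nfderiv phi N x - nfderiv phi N y| <= C * `|x - y| `^ (r - N%:R).

(** Apply [taylor_remainder] on the segment from [x] to [x + h]: the top derivative oscillates by at
    most [C * b ^ (r - N)] and is evaluated on [N] copies of [h]. *)
Lemma holder_taylor x h b : `|h| <= b ->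
  `|phi (x + h) - \sum_(k < N.+1) taylor_term phi x k h| <= C * b `^ r.
Proof.
move=> hb; have b0 : 0 <= b := le_trans (normr_ge0 _) hb.
pose g k t := diag (nfderiv phi k (x + t *: h)) h.
have dg k t : (k < N)%N -> is_derive (t : R^o) (1 : R^o) (g k : R^o -> R^o) (g k.+1 t).
  by move=> kN; apply: is_derive_diag_nfderiv; exact: dphi.
have gM t : 0 <= t <= 1 -> `|g N t - g N 0| <= C * b `^ r.
  move=> /andP[t0 t1]; rewrite /g scale0r addr0.
  have -> : diag (nfderiv phi N (x + t *: h)) h - diag (nfderiv phi N x) h =
      diag (nfderiv phi N (x + t *: h) - nfderiv phi N x) h.
    have := diag_linear h (-1) (nfderiv phi N x) (nfderiv phi N (x + t *: h)).
    by rewrite !scaleN1r ![- _ + _]addrC => ->.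
  apply: (le_trans (diag_bound _ _)).
  have -> : b `^ r = b `^ (r - N%:R) * b ^+ N.
    by rewrite -powR_mulrn// -powRD subrK// gt_eqF// (le_lt_trans (ler0n _ _) Nr).
  rewrite mulrA ler_pM ?exprn_ge0//; last by rewrite lerXn2r ?nnegrE.
  apply: (le_trans (hphi _ _)); rewrite ler_wpM2l ?(ltW C0)//.
  rewrite ge0_ler_powR ?nnegrE ?subr_ge0 ?(ltW Nr)//.
  by rewrite addrAC subrr add0r normrZ ger0_norm// (le_trans _ hb)// ler_piMl.
have := taylor_remainder dg gM (t := 1); rewrite ler01 lexx => /(_ isT).
rewrite /g scale1r horner_poly.
rewrite (eq_bigr (fun k : 'I_N.+1 => taylor_term phi x k h))//.
by move=> k _; rewrite expr1n mulr1 scale0r addr0.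
Qed.

Lemma bounded_on_balls b : exists2 B, 0 <= B & forall y, `|y| <= b -> `|phi y| <= B.
Proof.
have [b0|b0] := ltP b 0.
  by exists 0 => // y yb; have := le_lt_trans yb b0; rewrite ltNge normr_ge0.
exists (\sum_(k < N.+1) `|nfderiv phi k 0| * b ^+ k + C * b `^ r).
  rewrite addr_ge0 ?mulr_ge0 ?(ltW C0) ?powR_ge0//.
  by apply: sumr_ge0 => k _; rewrite mulr_ge0 ?exprn_ge0.
move=> y yb; have := holder_taylor 0 yb; rewrite add0r => hy.
rewrite -[phi y](subrKC (\sum_(k < N.+1) taylor_term phi 0 k y)).
apply: (le_trans (ler_normD _ _)); rewrite lerD//.
apply: (le_trans (ler_norm_sum _ _ _)); apply: ler_sum => k _.
rewrite normrM normfV normr_nat ler_pdivrMr ?ltr0n ?fact_gt0//.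
apply: (le_trans (diag_bound _ _)); rewrite -[leLHS]mulr1 ler_pM ?mulr_ge0 ?exprn_ge0//.
  by rewrite ler_wpM2l// lerXn2r ?nnegrE.
by rewrite ler1n fact_gt0.
Qed.

(** A Taylor term is a coefficient of the whole Taylor polynomial on the line spanned by [h], hence
    a combination of its values at [j h], [j <= N]. These are within [C * N ^ r] of values of [phi]
    on the ball of radius [b + N], where [phi] is bounded. *)
Lemma taylor_terms_bounded b : exists2 K, 0 <= K & forall k x h,
  (k <= N)%N -> `|x| <= b -> `|h| <= 1 -> `|taylor_term phi x k h| <= K.
Proof.
have [L L0 LP] := line_coef_bound X N.
have [B B0 BP] := bounded_on_balls (b + N%:R).
pose B' := B + C * N%:R `^ r.
have B'0 : 0 <= B' by rewrite addr_ge0 ?mulr_ge0 ?(ltW C0) ?powR_ge0.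
exists (L * B'); first exact: mulr_ge0.
move=> k x h kN xb h1.
pose G y := \sum_(i < N.+1) taylor_term phi x i y.
pose p := \poly_(i < N.+1) taylor_term phi x i h.
have -> : taylor_term phi x k h = line_coef N k G 0 h.
  rewrite (@line_coefE _ _ _ _ _ _ _ p) ?size_poly//; first by rewrite coef_poly ltnS kN.
  move=> t; rewrite add0r horner_poly; apply: eq_bigr => i _.
  by rewrite taylor_term_homog mulrC.
apply: LP => // j jN; rewrite add0r.
have jh : `|j%:R *: h| <= N%:R.
  by rewrite normrZ normr_nat -[leRHS]mulr1 ler_pM// ler_nat.
have := holder_taylor x jh; rewrite -/(G _) => hG.
have : `|phi (x + j%:R *: h)| <= B.
  by apply: BP; rewrite (le_trans (ler_normD _ _))// lerD.
move=> hB; rewrite -[G _](subKr (phi (x + j%:R *: h))).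
by rewrite (le_trans (ler_normB _ _))// lerD.
Qed.

(** Terms of degree at most [m] are made small by [few_large_values], terms of higher degree are
    [O(s ^ m.+1)], and the remainder is [O(s ^ r)]; all are [O(s ^ e)]. The size [n0] is uniform in
    [x], since the bounds of [taylor_terms_bounded] are. *)
Lemma almost_invariant_step (m : nat) (t beta : nat -> R) (e rho : R) :
  (m <= N)%N -> e <= r -> e <= m.+1%:R ->
  (forall k, 0 < t k <= 1) -> (forall n, 0 <= beta n) ->
  (forall (l : nat) (a b : R), (0 < l <= m)%N -> 0 < a -> 0 <= b ->
     exists n, b * beta n ^+ l < a * \sum_(k < n) t k ^+ l) ->
  exists2 K, 0 <= K & forall s, 0 < s <= 1 ->
  exists n0, forall x (u : nat -> X) (S : seq nat),
    `|x| <= rho -> uniq S -> (forall j, j \in S -> `|u j| <= 1) ->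
    upper_family t beta u S -> (n0 < size S)%N ->
    exists2 j, j \in S & `|phi (x + s *: u j) - phi x| <= K * s `^ e.
Proof.
move=> mN er em t01 beta0 key.
have [K K0 KP] := taylor_terms_bounded rho.
exists (N%:R * (1 + K) + C) => [|s /andP[s0 s1]].
  by rewrite addr_ge0 ?(ltW C0)// mulr_ge0// addr_ge0.
have se0 : 0 < s `^ e by rewrite powR_gt0.
have /choice[f fP] : forall i, exists n0, (0 < i <= m)%N ->
    forall (G : X -> R) (u : nat -> X) (S : seq nat),
    line_poly N G -> homogeneous i G -> (forall y, `|y| <= 1 -> `|G y| <= K) ->
    uniq S -> (forall j, j \in S -> `|u j| <= 1) -> upper_family t beta u S ->
    (count (fun j => (s `^ e < G (u j))%R) S <= n0)%N.
  move=> i; have [im|_] := boolP (0 < i <= m)%N; last by exists 0%N.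
  have [n0 n0P] := few_large_values X mN t01 beta0 key im K0 se0.
  by exists n0.
exists (\sum_(i < m.+1) (f i + f i))%N => x u S xrho uS Sn uf bigS.
pose T i := taylor_term phi x i.
pose P i j := (0 < i)%N && (s `^ e < `|T i (u j)|).
have [|j jS jP] := @exists_avoiding S P (fun i => f i + f i)%N m.+1 _ bigS.
  move=> i im; have [i0|i0] := posnP i.
    by rewrite (@eq_count _ _ pred0) ?count_pred0// => j; rewrite /P i0.
  (* An absolute value is large when the term or its opposite is; each sign costs [f i]
     exceptions. *)
  rewrite (@eq_count _ _ (predU (fun j => s `^ e < T i (u j))
      (fun j => s `^ e < - T i (u j)))); last first.
    by move=> j; rewrite /P i0/= lter_normr.
  have iN : (i <= N)%N by rewrite (leq_trans _ mN).
  apply: (leq_trans (leq_addr (count (predI (fun j => s `^ e < T i (u j))%R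
    (fun j => s `^ e < - T i (u j))%R) S) _)).
  rewrite count_predUI; apply: leq_add.
    apply: (fP i _ (T i)) => //; first by rewrite i0.
    - exact: taylor_term_lines.
    - exact: taylor_term_homog.
    - by move=> y y1; apply: KP.
  apply: (fP i _ (fun y => - T i y)) => //; first by rewrite i0.
  - exact/line_polyN/taylor_term_lines.
  - by move=> a h; rewrite /T taylor_term_homog mulrN.
  - by move=> y y1; rewrite normrN; apply: KP.
exists j => //.
have su : `|s *: u j| <= s by rewrite normrZ gtr0_norm// ler_piMr ?(ltW s0)// Sn.
have := holder_taylor x su; rewrite big_ord_recl taylor_term0 /= => hT.
have sr : s `^ r <= s `^ e by apply: ger_powR => //; rewrite s0.
rewrite -[phi (x + _) - _](subrK (\sum_(i < N) taylor_term phi x (lift ord0 i) (s *: u j))).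
rewrite [leRHS]mulrDl [leRHS]addrC (le_trans (ler_normD _ _))// lerD//.
  by rewrite -addrA -opprD (le_trans hT)// ler_wpM2l// ltW.
apply: (le_trans (ler_norm_sum _ _ _)).
apply: (@le_trans _ _ (\sum_(i < N) ((1 + K) * s `^ e))); last first.
  by rewrite sumr_const card_ord -mulrA mulr_natl.
apply: ler_sum => i _; rewrite taylor_term_homog normrM ger0_norm ?exprn_ge0 ?(ltW s0)//.
(* The summand indexed by [i] has degree [i + 1], so the first case covers the degrees up to [m]. *)
have [im|im] := ltnP i m.
  have := jP i.+1 im; rewrite /P/= -leNgt => Ti.
  rewrite mulrDl mul1r (le_trans _ (_ : s `^ e <= _)) ?lerDl ?mulr_ge0 ?(ltW se0)//.
  rewrite (le_trans _ Ti)// ler_piMl// exprn_ile1// ltW//.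
rewrite mulrC ler_pM ?exprn_ge0 ?(ltW s0)//.
  apply: (@le_trans _ _ K); last by rewrite lerDr.
  by apply: KP => //; [rewrite -ltnS ltn_ord|exact: Sn].
rewrite -powR_mulrn ?(ltW s0)//; apply: ger_powR; first by rewrite s0.
by apply: (le_trans em); rewrite ler_nat.
Qed.

End HolderTaylor.
End GreedySteps.

Lemma exists_large_powR (R : realType) (a b x y : R) : 0 < x -> 0 < y -> 0 <= a -> 0 <= b ->
  exists n, [/\ (0 < n)%N, a <= n%:R `^ x & b < n%:R `^ y].
Proof.
move=> x0 y0 a0 b0.
pose n := (Num.Def.archi_bound (a `^ x^-1 + b `^ y^-1)).+1.
have nab : a `^ x^-1 + b `^ y^-1 < n%:R.
  rewrite (lt_le_trans (archi_boundP _)) ?addr_ge0 ?powR_ge0// ler_nat.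
  exact: leqnSn.
exists n; split=> //; clearbody n.
  have -> : a = (a `^ x^-1) `^ x by rewrite -powRrM mulVf ?lt0r_neq0// powRr1.
  apply: ge0_ler_powR; rewrite ?nnegrE ?powR_ge0 ?(ltW x0)//.
  by rewrite (le_trans _ (ltW nab))// lerDl powR_ge0.
have -> : b = (b `^ y^-1) `^ y by rewrite -powRrM mulVf ?lt0r_neq0// powRr1.
apply: gt0_ltr_powR; rewrite ?nnegrE ?powR_ge0//.
by rewrite (le_lt_trans _ nab)// lerDr powR_ge0.
Qed.

Section NoBump.
Context (R : realType) (X : normedModType R).

(** Stage [i] offers the [n0] vectors [u i j]. The lower bound is required for every selection,
    because [phi] decides which member is used at each stage. *)
Definition rich_in_families (d c : R) (t beta : nat -> R) := forall n n0,
  exists u : nat -> nat -> X, [/\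
    forall i j, (i < n)%N -> (j < n0)%N -> `|u i j| <= 1,
    forall i, (i < n)%N -> upper_family t beta (u i) (iota 0 n0)
  & forall f : nat -> nat, (forall i, f i < n0)%N ->
      c * n%:R `^ d^-1 <= `|\sum_(i < n) u i (f i)|].

(* Starting where [phi <> 0], [n] steps of length [b * n ^ (- 1 / d)] change
   [phi] by [O(n * n ^ (- e / d)) = o(1)], yet they can be made to leave the
   support. *)
Lemma not_UH_smooth (d c r : R) (m : nat) (t beta : nat -> R) :
  0 < d -> 0 < c -> d < r -> m%:R <= d < m.+1%:R ->
  (forall k, 0 < t k <= 1) -> (forall n, 0 <= beta n) ->
  (forall (l : nat) (a b : R), (0 < l <= m)%N -> 0 < a -> 0 <= b ->
     exists n, b * beta n ^+ l < a * \sum_(k < n) t k ^+ l) ->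
  rich_in_families d c t beta -> ~ UH_smooth X r.
Proof.
move=> d0 c0 dr /andP[md dm] t01 beta0 key rich.
move=> [phi [[N [/andP[Nr rN] dphi [C C0 hphi]]] bsupp [z zsupp]]].
have [x0 phix0] : exists x0, phi x0 != 0.
  apply: contrapT => no0; move: zsupp; rewrite /supp.
  have -> : [set x | phi x != 0] = set0.
    by apply/seteqP; split=> // x phix; apply: no0; exists x.
  by rewrite closure0.
have [rho rho0 suppP] : exists2 rho, 0 <= rho & forall x, phi x != 0 -> `|x| <= rho.
  have [M [_ MP]] := bsupp; exists (Num.max 0 (M + 1)); first by rewrite le_max lexx.
  move=> x phix; rewrite le_max; apply/orP; right.
  apply: (MP (M + 1)); first by rewrite ltrDl.
  exact: subset_closure.
have mN : (m <= N)%N by rewrite -ltnS -(ltr_nat R) (le_lt_trans md)// (lt_le_trans dr).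
(* This exponent serves both the remainder and the terms of degree above [m], and still exceeds
   [d]. *)
pose e := Num.min r m.+1%:R.
have er : e <= r by rewrite ge_min lexx.
have em : e <= m.+1%:R by rewrite ge_min lexx orbT.
have de : d < e by rewrite lt_min dr.
have [K K0 step] := almost_invariant_step Nr C0 dphi hphi rho mN er em t01 beta0 key.
pose a := `|phi x0|; have a0 : 0 < a by rewrite normr_gt0.
(* Chosen so that [n] steps of length [s = b / n ^ (1 / d)] add up to a vector of norm at least
   [c * b = rho + |x0| + 1]. *)
pose b := (rho + `|x0| + 1) / c.
have b0 : 0 < b by rewrite divr_gt0// ltr_wpDl// addr_ge0.
have dV0 : 0 < d^-1 by rewrite invr_gt0.
have ed : 0 < e / d - 1 by rewrite subr_gt0 ltr_pdivlMr// mul1r.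
(* The first bound gives [s <= 1]; the second makes the total change [n * K * s ^ e] less than
   [|phi x0|], since [e / d > 1]. *)
have [|n [n0 bn an]] := @exists_large_powR _ b (K * b `^ e / a) _ _ dV0 ed (ltW b0).
  by rewrite !mulr_ge0 ?powR_ge0 ?invr_ge0 ?(ltW a0).
have nR0 : 0 < n%:R :> R by rewrite ltr0n.
pose s := b / n%:R `^ d^-1.
have s0 : 0 < s by rewrite divr_gt0// powR_gt0.
have s1 : s <= 1 by rewrite ler_pdivrMr ?powR_gt0// mul1r.
have small : n%:R * (K * s `^ e) < a.
  rewrite ltr_pdivrMr// in an.
  have -> : s `^ e = b `^ e / n%:R `^ (e / d).
    rewrite /s powRM ?invr_ge0 ?powR_ge0 ?(ltW b0)//; congr (_ * _).
    by rewrite -!powRN -powRrM; congr (_ `^ _); ring.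
  have nn : n%:R `^ (e / d) = n%:R * n%:R `^ (e / d - 1) :> R.
    by rewrite mulr_powRB1// divr_gt0// (lt_trans d0).
  have n1 : 0 < n%:R `^ (e / d - 1) :> R by rewrite powR_gt0.
  rewrite nn; set P := _ `^ (e / d - 1) in an n1 *.
  have -> : n%:R * (K * (b `^ e / (n%:R * P))) = K * b `^ e / P.
    by field; rewrite !gt_eqF.
  by rewrite ltr_pdivrMr// [a * _]mulrC.
have [M0 M0P] := step s (introT andP (conj s0 s1)).
have [u [u1 uf ulow]] := rich n M0.+1.
have : forall k, (k <= n)%N -> exists f : nat -> nat, (forall i, f i < M0.+1)%N /\
    `|phi (x0 + s *: \sum_(i < k) u i (f i)) - phi x0| <= k%:R * (K * s `^ e).
  elim=> [_|k IH kn].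
    exists (fun=> 0%N); split=> //.
    by rewrite big_ord0 scaler0 addr0 subrr normr0 mul0r.
  have [f [fM fk]] := IH (ltnW kn).
  set x := x0 + _ in fk.
  (* So far [phi] has changed by less than [|phi x0|], so it is nonzero at [x], and the step lemma
     applies there. *)
  have xrho : `|x| <= rho.
    apply: suppP; apply/eqP => phi0.
    move: fk; rewrite phi0 sub0r normrN leNgt => /negP; apply.
    by apply: le_lt_trans small; rewrite ler_wpM2r ?mulr_ge0 ?powR_ge0// ler_nat ltnW.
  have [||j jM jP] := M0P x (u k) (iota 0 M0.+1) xrho (iota_uniq _ _) _ (uf k kn).
  - by move=> j; rewrite mem_iota => /andP[_ jM]; exact: u1.
  - by rewrite size_iota.
  exists (fun i => if i == k then j else f i); split.
    by move=> i; case: eqP => // _; move: jM; rewrite mem_iota.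
  rewrite big_ord_recr/= eqxx (eq_bigr (fun i : 'I_k => u i (f i))); last first.
    by move=> i _; rewrite ltn_eqF.
  rewrite scalerDr addrA -/x -addn1 natrD mulrDl mul1r.
  rewrite -[phi (x + _)](subrK (phi x)) -addrA addrC.
  by rewrite (le_trans (ler_normD _ _))// lerD.
move=> /(_ n (leqnn n))[f [fM fn]].
set x := x0 + _ in fn.
have : `|x| <= rho.
  apply: suppP; apply/eqP => phi0.
  by move: fn; rewrite phi0 sub0r normrN leNgt => /negP; apply.
rewrite leNgt => /negP; apply.
have := ulow f fM; rewrite -(ler_pM2l s0) => low.
have : s * `|\sum_(i < n) u i (f i)| <= `|x| + `|x0|.
  rewrite -{1}(gtr0_norm s0) -normrZ -[s *: _](addKr x0) addrC.
  by rewrite (le_trans (ler_normD _ _))// normrN.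
move=> /(le_trans low).
have -> : s * (c * n%:R `^ d^-1) = rho + `|x0| + 1.
  by rewrite /s mulrCA divfK ?lt0r_neq0 ?powR_gt0// /b mulrC divfK ?lt0r_neq0.
lra.
Qed.

End NoBump.

(** * Finite-dimensional Lorentz spaces *)

Section LorentzCoordinates.
Context (R : realType) (p q : R).
Hypotheses (p0 : 0 < p) (q0 : 0 < q).

Definition lorentz_wt (k : nat) : R := k.+1%:R `^ (q / p) - k%:R `^ (q / p).

(** For nonnegative decreasing [t], the [q]-th power of the norm of [l_{p,q}^n]. *)
Definition lorentz_sum (n : nat) (t : nat -> R) : R :=
  \sum_(k < n) t k `^ q * lorentz_wt k.

(* [t k] is an upper (resp. lower) bound for the [k]-th largest of the [D]
   numbers [|x a|], [a < D]. *)
Definition lorentz_coordinates (X : normedModType R) := exists c C : R,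
  [/\ 0 < c, 0 < C & forall D : nat, exists E : (nat -> R) -> X,
  [/\ forall (b : R) (x y : nat -> R), E (fun a => b * x a + y a) = b *: E x + E y,
      forall (x t : nat -> R) (n : nat), (forall k, (k < n)%N -> 0 <= t k) ->
        (forall k, (k < n)%N -> (count (fun a => (t k < `|x a|)%R) (iota 0 D) <= k)%N) ->
        (count (fun a => (x a != 0)%R) (iota 0 D) <= n)%N ->
        `|E x| <= C * lorentz_sum n t `^ q^-1
    & forall (x t : nat -> R) (n : nat), (forall k, (k < n)%N -> 0 <= t k) ->
        (forall k, (k < n)%N -> (k < count (fun a => (t k <= `|x a|)%R) (iota 0 D))%N) ->
        c * lorentz_sum n t `^ q^-1 <= `|E x| ]].

Let w0 : 0 < q / p. Proof. by rewrite divr_gt0. Qed.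

Lemma lorentz_wt_ge0 k : 0 <= lorentz_wt k.
Proof.
rewrite subr_ge0 ge0_ler_powR ?nnegrE ?ler_nat//; exact: ltW.
Qed.

Lemma sum_lorentz_wt m n : (m <= n)%N ->
  \sum_(m <= k < n) lorentz_wt k = n%:R `^ (q / p) - m%:R `^ (q / p).
Proof. by move=> mn; rewrite (telescope_sumr (fun k => k%:R `^ (q / p))). Qed.

Lemma lorentz_sum_cst n (t : R) : 0 <= t ->
  lorentz_sum n (fun=> t) = t `^ q * n%:R `^ (q / p).
Proof.
move=> t0; rewrite /lorentz_sum -mulr_sumr -(big_mkord xpredT lorentz_wt).
by rewrite sum_lorentz_wt// powR0 ?subr0// gt_eqF.
Qed.

Lemma lorentz_sum_ge0 n t : 0 <= lorentz_sum n t.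
Proof.
by apply: sumr_ge0 => k _; rewrite mulr_ge0 ?powR_ge0 ?lorentz_wt_ge0.
Qed.

(** Repeating every entry [L] times multiplies the norm by [L ^ (1 / p)]: over one block the weights
    telescope to [L ^ (q / p)] times a single weight. *)
Lemma lorentz_sum_blocks n L t : (0 < L)%N -> (forall k, 0 <= t k) ->
  lorentz_sum (n * L) (fun k => L%:R `^ (- p^-1) * t (k %/ L)%N) = lorentz_sum n t.
Proof.
move=> L0 t0; have LR : 0 < L%:R :> R by rewrite ltr0n.
rewrite /lorentz_sum; elim: n => [|n IH]; first by rewrite mul0n !big_ord0.
rewrite -[in LHS](big_mkord xpredT
  (fun k => (L%:R `^ (- p^-1) * t (k %/ L)%N) `^ q * lorentz_wt k)).
rewrite mulSn addnC (big_cat_nat _ (n := (n * L)%N)) ?leq_addr//=.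
rewrite big_mkord IH [RHS]big_ord_recr/=; congr (_ + _).
rewrite (eq_big_nat _ _ (F2 := fun k => L%:R `^ (- (q / p)) * t n `^ q * lorentz_wt k)); last first.
  move=> k /andP[k1 k2]; congr (_ * _).
  have -> : (k %/ L = n)%N.
    by apply/eqP; rewrite eqn_leq leq_divRL// k1 -ltnS ltn_divLR// mulSn addnC k2.
  by rewrite powRM ?powR_ge0// -powRrM mulNr [p^-1 * q]mulrC.
rewrite -mulr_sumr sum_lorentz_wt ?leq_addr// -[(n * L + L)%N]addnC -mulSn !natrM !powRM//.
rewrite powRN /lorentz_wt -mulrBl; set A := L%:R `^ (q / p).
have A0 : A != 0 by rewrite lt0r_neq0// powR_gt0.
by field.
Qed.

Context (X : normedModType R).

Section Embedding.
Variables (D : nat) (E : (nat -> R) -> X).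
Hypothesis El : forall (b : R) (x y : nat -> R), E (fun a => b * x a + y a) = b *: E x + E y.

Lemma coords_sum n (b : nat -> R) (x : nat -> nat -> R) :
  E (fun a => \sum_(k < n) b k * x k a) = \sum_(k < n) b k *: E (x k).
Proof.
elim: n => [|n IH].
  rewrite big_ord0; have := El (-1) (fun=> 0) (fun=> 0); rewrite scaleN1r addNr => <-.
  by congr E; apply/funext => a; rewrite big_ord0 mulr0 addr0.
rewrite big_ord_recr/= -IH addrC -El; congr E; apply/funext => a.
by rewrite big_ord_recr/= addrC.
Qed.

Variables (C : R) (C0 : 0 < C).
Hypothesis EU : forall (x t : nat -> R) (n : nat), (forall k, (k < n)%N -> 0 <= t k) ->
  (forall k, (k < n)%N -> (count (fun a => (t k < `|x a|)%R) (iota 0 D) <= k)%N) ->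
  (count (fun a => (x a != 0)%R) (iota 0 D) <= n)%N ->
  `|E x| <= C * lorentz_sum n t `^ q^-1.

(* The indicator of the [g j]-th block of [L] coordinates, scaled to norm at most [1]. *)
Definition block_vector (L : nat) (g : nat -> nat) (j : nat) : X :=
  (C^-1 * L%:R `^ (- p^-1)) *: E (fun a => (a %/ L == g j)%N%:R).

(** Since [g] is injective the blocks are disjoint, so the combination takes each value
    [L ^ (- 1 / p) * t k], up to the factor [C^-1], on at most [L] coordinates; conclude by
    [lorentz_sum_blocks]. *)
Lemma block_vector_upper_family L g t S : (0 < L)%N -> injective g ->
  (forall k, 0 <= t k) -> {homo t : i j / (i <= j)%N >-> j <= i} ->
  upper_family t (fun n => lorentz_sum n t `^ q^-1) (block_vector L g) S.
Proof.
move=> L0 gi t0 tn s us _.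
have LR : 0 < L%:R `^ (- p^-1) :> R by rewrite powR_gt0// ltr0n.
pose x a : R := \sum_(k < size s) (L%:R `^ (- p^-1) * t k) * (a %/ L == g (nth 0%N s k))%N%:R.
have -> : \sum_(k < size s) t k *: block_vector L g (nth 0%N s k) = C^-1 *: E x.
  rewrite (coords_sum (size s) (fun k => L%:R `^ (- p^-1) * t k)
    (fun k a => (a %/ L == g (nth 0%N s k))%N%:R)).
  rewrite scaler_sumr; apply: eq_bigr => k _.
  by rewrite /block_vector !scalerA; congr (_ *: _); ring.
have xk a k : (k < size s)%N -> (a %/ L == g (nth 0%N s k))%N -> x a = L%:R `^ (- p^-1) * t k.
  move=> ks ak; rewrite /x (bigD1 (Ordinal ks))//= ak mulr1 big1 ?addr0// => i ik.
  rewrite (eqP ak) (inj_eq gi) nth_uniq//.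
  by move: ik; rewrite -val_eqE/= eq_sym => /negbTE ->; rewrite mulr0.
have x0 a : x a != 0 -> exists2 k, (k < size s)%N & (a %/ L == g (nth 0%N s k))%N.
  move=> xa; apply: contrapT => no; move: xa; rewrite /x big1 ?eqxx// => i _.
  by case: eqP => [e|_]; rewrite ?mulr0//; exfalso; apply: no; exists i => //; apply/eqP.
(* Coordinates confined to the first [n] selected blocks number at most [n * L]. *)
have cnt (P : pred nat) n :
    (forall a, P a -> exists2 k, (k < minn n (size s))%N & (a %/ L == g (nth 0%N s k))%N) ->
    (count P (iota 0 D) <= n * L)%N.
  move=> Pn; rewrite -size_filter.
  apply: (@leq_trans (size [seq (g j * L + b)%N | j <- take n s, b <- iota 0 L])).
    apply: uniq_leq_size; first by rewrite filter_uniq ?iota_uniq.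
    move=> a; rewrite mem_filter => /andP[/Pn[k]]; rewrite leq_min => /andP[kn ks] /eqP ak _.
    apply/allpairsP; exists (nth 0%N s k, a %% L)%N; split=> /=.
    - by rewrite -(nth_take _ kn) mem_nth// size_take_min leq_min kn.
    - by rewrite mem_iota/= ltn_mod.
    - by rewrite -ak -divn_eq.
  by rewrite size_allpairs size_iota leq_mul2r size_take_min geq_minl orbT.
rewrite normrZ gtr0_norm ?invr_gt0// ler_pdivrMl//.
rewrite -(lorentz_sum_blocks (size s) L0 t0); apply: EU.
- by move=> k _; rewrite mulr_ge0 ?(ltW LR).
- move=> k kn; apply: leq_trans (leq_trunc_div k L).
  apply: cnt => a; have [->|xa] := eqVneq (x a) 0.
    by rewrite normr0 ltNge mulr_ge0 ?(ltW LR).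
  have [i iS ai] := x0 a xa; rewrite (xk a i iS ai) ger0_norm ?mulr_ge0 ?(ltW LR)// ltr_pM2l//.
  move=> tki; exists i => //; rewrite leq_min iS andbT ltnNge; apply/negP => /tn.
  by rewrite leNgt tki.
- by apply: cnt => a /x0[k ks ak]; exists k => //; rewrite minnn.
Qed.

Variables (c : R) (c0 : 0 < c).
Hypothesis EL : forall (x t : nat -> R) (n : nat), (forall k, (k < n)%N -> 0 <= t k) ->
  (forall k, (k < n)%N -> (k < count (fun a => (t k <= `|x a|)%R) (iota 0 D))%N) ->
  c * lorentz_sum n t `^ q^-1 <= `|E x|.

(** Blocks of different stages may overlap; as all entries are nonnegative, each coordinate of the
    sum still dominates the entry of any single block containing it. *)
Lemma block_vector_sum_lower n (L : nat -> nat) (g : nat -> nat -> nat) (f : nat -> nat) N t :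
  (forall k, (k < N)%N -> 0 <= t k) ->
  (forall k, (k < N)%N -> (k < count (fun a => [exists i : 'I_n,
    (t k <= (L i)%:R `^ (- p^-1))%R && (a %/ L i == g i (f i))]) (iota 0 D))%N) ->
  c / C * lorentz_sum N t `^ q^-1 <= `|\sum_(i < n) block_vector (L i) (g i) (f i)|.
Proof.
move=> t0 tN.
pose x a : R := \sum_(i < n) (L i)%:R `^ (- p^-1) * (a %/ L i == g i (f i))%N%:R.
have -> : \sum_(i < n) block_vector (L i) (g i) (f i) = C^-1 *: E x.
  rewrite (coords_sum n (fun i => (L i)%:R `^ (- p^-1))
    (fun i a => (a %/ L i == g i (f i))%N%:R)).
  by rewrite scaler_sumr; apply: eq_bigr => i _; rewrite /block_vector scalerA.
rewrite normrZ gtr0_norm ?invr_gt0// mulrAC mulrC ler_wpM2l ?invr_ge0 ?(ltW C0)//.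
apply: EL => // k kN; apply: (leq_trans (tN k kN)); apply: sub_count => a /=.
move=> /existsP[i /andP[ti ai]].
apply: (le_trans ti); apply: (le_trans _ (ler_norm _)).
rewrite /x (bigD1 i)//= ai mulr1 lerDl.
by apply: sumr_ge0 => j _; rewrite mulr_ge0 ?powR_ge0.
Qed.

End Embedding.

Lemma upper_family_unit (t : nat -> R) (u : nat -> X) S j : t 0%N = 1 ->
  upper_family t (fun n => lorentz_sum n t `^ q^-1) u S -> j \in S -> `|u j| <= 1.
Proof.
move=> t1 uf jS; have := uf [:: j] isT; rewrite big_ord1/= t1 scale1r => /(_ _)/le_trans.
apply; first by move=> k; rewrite inE => /eqP->.
suff -> : lorentz_sum 1 t = 1 by rewrite powR1.
by rewrite /lorentz_sum big_ord1/= t1 /lorentz_wt powR0 ?gt_eqF// subr0 mulr1n !powR1 mulr1.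
Qed.

(* Stage [i] uses single coordinates; the weights [k ^ (- 1 / p)] also exclude the
   degree [k = p], through the divergence of the harmonic series. *)
Lemma rich_lp : lorentz_coordinates X ->
  exists2 c, 0 < c & rich_in_families X p c (fun k => k.+1%:R `^ (- p^-1))
    (fun n => lorentz_sum n (fun k => k.+1%:R `^ (- p^-1)) `^ q^-1).
Proof.
move=> [c [C [c0 C0 coords]]]; exists (c / C); first exact: divr_gt0.
move=> n n0; have [E [El EU EL]] := coords (n * n0)%N.
pose g i j := (i * n0 + j)%N.
set t := fun k : nat => k.+1%:R `^ (- p^-1).
have t0 k : 0 <= t k by exact: powR_ge0.
have tn : {homo t : i j / (i <= j)%N >-> j <= i}.
  move=> i j ij; rewrite /t !powRN lef_pV2 ?posrE ?powR_gt0//.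
  by rewrite ge0_ler_powR ?nnegrE ?invr_ge0 ?(ltW p0)// ler_nat ltnS.
have uf i : upper_family t (fun n => lorentz_sum n t `^ q^-1)
    (block_vector E C 1 (g i)) (iota 0 n0).
  by apply: (block_vector_upper_family El C0 EU) => // j k /addnI.
exists (fun i => block_vector E C 1 (g i)); split=> //.
  move=> i j _ jn; apply: (upper_family_unit _ (uf i)); first by rewrite /t powR1.
  by rewrite mem_iota.
move=> f fn.
have -> : n%:R `^ p^-1 = lorentz_sum n (fun=> 1) `^ q^-1.
  by rewrite lorentz_sum_cst// powR1 mul1r -powRrM mulrAC mulfV ?mul1r// gt_eqF.
(* The numbering [g] separates the stages, so the [n] selected coordinates are distinct. *)
apply: (block_vector_sum_lower El C0 EL (L := fun=> 1%N) (g := g)) => // k kn.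
apply: (leq_trans kn); rewrite -size_filter -[leqLHS](size_iota 0) -(size_map (fun i => g i (f i))).
apply: uniq_leq_size.
  rewrite map_inj_in_uniq ?iota_uniq// => i j _ _ /(congr1 (divn^~ n0)).
  by rewrite /g !divnMDl ?divn_small ?addn0// (leq_ltn_trans _ (fn 0%N)).
move=> _ /mapP[i + ->]; rewrite mem_iota add0n /= => im.
rewrite mem_filter mem_iota/= add0n; apply/andP; split.
  by apply/existsP; exists (Ordinal im); rewrite divn1 powR1 lexx/=.
rewrite /g (@leq_trans (i * n0 + n0)%N) ?ltn_add2l//.
by rewrite -mulSnr leq_mul2r im orbT.
Qed.

(* Stage [i] uses the blocks of length [2 ^ i]. *)
Lemma rich_lq : lorentz_coordinates X ->
  exists2 c, 0 < c & rich_in_families X q c (fun=> 1) (fun n => lorentz_sum n (fun=> 1) `^ q^-1).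
Proof.
move=> [c [C [c0 C0 coords]]].
have gap : 0 < 1 - 2 `^ (- (q / p)) :> R.
  rewrite subr_gt0 powRN invf_lt1 ?powR_gt0//.
  rewrite [ltLHS](_ : 1 = 1 `^ (q / p)); last by rewrite powR1.
  by apply: gt0_ltr_powR; rewrite ?nnegrE// ltr1n.
exists (c / C * (1 - 2 `^ (- (q / p))) `^ q^-1); first by rewrite mulr_gt0 ?divr_gt0// powR_gt0.
move=> n n0; have [E [El EU EL]] := coords (n0 * 2 ^ n)%N.
have uf i : upper_family (fun=> 1) (fun n => lorentz_sum n (fun=> 1) `^ q^-1)
    (block_vector E C (2 ^ i) id) (iota 0 n0).
  by apply: (block_vector_upper_family El C0 EU) => //; rewrite expn_gt0.
exists (fun i => block_vector E C (2 ^ i) id); split=> //.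
  by move=> i j _ jn; apply: (upper_family_unit _ (uf i)) => //; rewrite mem_iota.
move=> f fn.
case: n => [|n] in E El EU EL uf *.
  by rewrite powR0 ?mulr0 ?normr_ge0// invr_neq0// gt_eqF.
(* The [k]-th largest entry is at least the height of the shortest dyadic block with more than [k]
   coordinates. *)
pose t k : R := (2 ^ up_log 2 k.+1)%N%:R `^ (- p^-1).
(* Each dyadic range [[2 ^ m, 2 ^ m.+1)] contributes exactly [1 - 2 ^ (- q / p)], and the index 0
   contributes 1. *)
have sum_ge m : m.+1%:R * (1 - 2 `^ (- (q / p))) <= lorentz_sum (2 ^ m) t.
  rewrite /lorentz_sum; elim: m => [|m IH].
    rewrite expn0 big_ord1/= /t up_log1 expn0 !powR1 /lorentz_wt powR0 ?gt_eqF//.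
    by rewrite powR1 subr0 !mul1r gerBl powR_ge0.
  rewrite -(big_mkord xpredT (fun k => t k `^ q * lorentz_wt k)).
  rewrite (big_cat_nat _ (n := (2 ^ m)%N)) ?leq_pexp2l//= big_mkord.
  rewrite [m.+2%:R]mulrS mulrDl mul1r [leLHS]addrC lerD//.
  rewrite (eq_big_nat _ _
    (F2 := fun k => (2 ^ m.+1)%N%:R `^ (- p^-1) `^ q * lorentz_wt k)); last first.
    by move=> k /andP[k1 k2]; rewrite /t (@up_log_eq 2 m)//; rewrite ltnS k1 k2.
  rewrite -mulr_sumr sum_lorentz_wt ?leq_pexp2l// -powRrM mulNr [p^-1 * q]mulrC.
  rewrite mulrBr -powRD ?addNr; last first.
    by apply/implyP => _; rewrite pnatr_eq0 expn_eq0.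
  rewrite powRr0 lerB// expnS natrM powRM// -mulrA -powRD ?addNr ?powRr0 ?mulr1//.
  by apply/implyP => _; rewrite pnatr_eq0 expn_eq0.
apply: (@le_trans _ _ (c / C * lorentz_sum (2 ^ n) t `^ q^-1)).
  rewrite -mulrA ler_wpM2l ?divr_ge0 ?(ltW c0) ?(ltW C0)// -powRM ?(ltW gap)//.
  by rewrite ge0_ler_powR ?nnegrE ?invr_ge0 ?(ltW q0) ?mulr_ge0 ?(ltW gap) ?lorentz_sum_ge0// mulrC.
apply: (block_vector_sum_lower El C0 EL (L := fun i => (2 ^ i)%N) (g := fun=> id)) => [k _|k kn].
  exact: powR_ge0.
(* The block selected at stage [i] alone supplies the required [k + 1] coordinates. *)
set i := up_log 2 k.+1.
have im : (i < n.+1)%N by rewrite ltnS up_log_min.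
apply: (@leq_trans (2 ^ i)); first exact: up_logP.
rewrite -size_filter -[leqLHS](size_iota (f i * 2 ^ i)).
apply: uniq_leq_size; first exact: iota_uniq.
move=> a; rewrite mem_iota -mulSnr => /andP[a1 a2].
rewrite mem_filter mem_iota/= add0n; apply/andP; split.
  apply/existsP; exists (Ordinal im); rewrite lexx/= eqn_leq leq_divRL ?expn_gt0// a1.
  by rewrite andbT -ltnS ltn_divLR ?expn_gt0.
rewrite (leq_trans a2)// leq_mul// ?leq_pexp2l// ltnW//.
Qed.


End LorentzCoordinates.

(** * Growth conditions in the cases [q < p] and [p < q] *)

Section LorentzCoordinatesNotSmooth.
Context (R : realType) (p q : R).
Hypotheses (p1 : 1 < p) (q1 : 1 < q).

Let p0 : 0 < p. Proof. exact: lt_trans p1. Qed.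
Let q0 : 0 < q. Proof. exact: lt_trans q1. Qed.

(** The sum of [n] unit coordinates has norm [n ^ (1 / p)], and [n ^ (l / p) = o(n)]. *)
Lemma lq_growth (l : nat) (a b : R) : l%:R < p -> 0 < a -> 0 <= b ->
  exists n, b * (lorentz_sum p q n (fun=> 1) `^ q^-1) ^+ l < a * \sum_(k < n) 1 ^+ l.
Proof.
move=> lp a0 b0.
have y0 : 0 < 1 - l%:R / p by rewrite subr_gt0 ltr_pdivrMr ?mul1r.
have [|n [n0 _ bn]] := exists_large_powR y0 y0 (lexx 0) (b := b / a).
  by rewrite divr_ge0// ltW.
exists n; have nR : 0 < n%:R :> R by rewrite ltr0n.
rewrite lorentz_sum_cst// powR1 mul1r -powRrM mulrAC mulfV ?gt_eqF// mul1r.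
rewrite (eq_bigr (fun=> 1)) => [|k _]; last by rewrite expr1n.
rewrite sumr_const card_ord -powR_mulrn ?powR_ge0// -powRrM [p^-1 * _]mulrC.
rewrite ltr_pdivrMr// in bn.
have nE : n%:R = n%:R `^ (1 - l%:R / p) * n%:R `^ (l%:R / p) :> R.
  by rewrite -powRD ?subrK ?powRr1// gt_eqF// implybT.
by rewrite [X in _ < a * X]nE mulrA ltr_pM2r ?powR_gt0// [a * _]mulrC.
Qed.

Lemma bernoulli_powR (y : R) (W : nat) (w : R) : 0 <= y <= 1 -> 0 < w -> w <= W%:R ->
  1 - W%:R * y <= (1 - y) `^ w.
Proof.
move=> /andP[y0 y1] w0 wW.
have bern (n : nat) : 1 - n%:R * y <= (1 - y) ^+ n.
  elim: n => [|n IH]; first by rewrite mul0r subr0 expr0.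
  rewrite exprS; apply: (@le_trans _ _ ((1 - y) * (1 - n%:R * y))).
    have ny : 0 <= n%:R * y * y by rewrite !mulr_ge0.
    by rewrite -natr1; nra.
  by rewrite ler_wpM2l// subr_ge0.
(* The value [y = 1], where the base of the power vanishes, does occur: it is the index 0 in
   [lp_growth]. *)
apply: (le_trans (bern W)); have [->|y1'] := eqVneq y 1.
  rewrite subrr powR0 ?gt_eqF// expr0n; case: W wW => // h.
  by have := lt_le_trans w0 h; rewrite ltxx.
have : 0 < 1 - y by rewrite subr_gt0 lt_neqAle y1'.
move=> y10; rewrite -powR_mulrn ?(ltW y10)//; apply: ger_powR => //.
by rewrite y10 gerBl.
Qed.

Lemma harmonic_unbounded (A : R) : exists n, A < \sum_(k < n) k.+1%:R^-1.
Proof.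
have nd : nondecreasing_seq (series (@harmonic R)).
  by apply/nondecreasing_seqP => n; rewrite seriesSr lerDl ltW// harmonic_gt0.
have /cvgryPgt/(_ A)[n _ An] := nondecreasing_dvgn_lt nd (@dvg_harmonic R).
by exists n; have := An n (leqnn n); rewrite seriesEord.
Qed.

(** With [H] the harmonic sum, the [q]-th power of the norm is [O(H)] while the right-hand sum is at
    least [H], because [l <= p]. As [l / q < 1], the bound [H ^ (l / q) = o(H)] decides, also for
    [l = p]. *)
Lemma lp_growth (l : nat) (a b : R) : (0 < l)%N -> l%:R <= p -> p < q -> 0 < a -> 0 <= b ->
  exists n, b * (lorentz_sum p q n (fun k => k.+1%:R `^ (- p^-1)) `^ q^-1) ^+ l
    < a * \sum_(k < n) (k.+1%:R `^ (- p^-1)) ^+ l.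
Proof.
move=> l0 lp pq a0 b0.
have w0 : 0 < q / p by rewrite divr_gt0.
pose W := (Num.Def.archi_bound (q / p)).
have wW : q / p <= W%:R by rewrite ltW// archi_boundP// ltW.
have W0 : 0 < W%:R :> R by rewrite (lt_le_trans w0).
have y0 : 0 < 1 - l%:R / q by rewrite subr_gt0 ltr_pdivrMr ?mul1r// (le_lt_trans lp).
have [n Hn] := harmonic_unbounded (((W%:R * b / a) `^ (1 - l%:R / q)^-1) / W%:R).
exists n; set H := \sum_(k < n) _ in Hn.
pose z := W%:R * H.
have Az : (W%:R * b / a) `^ (1 - l%:R / q)^-1 < z by rewrite /z [ltRHS]mulrC -ltr_pdivrMr.
have z0 : 0 < z by rewrite (le_lt_trans _ Az)// powR_ge0.
have bz : W%:R * b / a < z `^ (1 - l%:R / q).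
  have -> : W%:R * b / a = ((W%:R * b / a) `^ (1 - l%:R / q)^-1) `^ (1 - l%:R / q).
    by rewrite -powRrM mulVf ?powRr1 ?gt_eqF// divr_ge0 ?mulr_ge0// ltW.
  by apply: gt0_ltr_powR; rewrite ?nnegrE ?powR_ge0// ltW.
(* The [k]-th summand is [1 - (1 - 1 / (k + 1)) ^ (q / p)], at most [W / (k + 1)] by Bernoulli's
   inequality. *)
have Sz : lorentz_sum p q n (fun k => k.+1%:R `^ (- p^-1)) <= z.
  rewrite /z mulr_sumr; apply: ler_sum => k _.
  have k0 : 0 < k.+1%:R :> R by rewrite ltr0n.
  rewrite -powRrM mulNr [p^-1 * q]mulrC /lorentz_wt mulrBr -powRD ?addNr ?powRr0; last first.
    by rewrite (gt_eqF k0) implybT.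
  have -> : k.+1%:R `^ (- (q / p)) * k%:R `^ (q / p) = (1 - k.+1%:R^-1) `^ (q / p) :> R.
    have -> : 1 - k.+1%:R^-1 = k.+1%:R^-1 * k%:R :> R.
      by rewrite -[X in X - _](mulVf (lt0r_neq0 k0)) -[X in _ - X]mulr1 -mulrBr -natr1 addrK.
    by rewrite powRM// ?invr_ge0// -[k.+1%:R^-1]powR_inv1// -powRrM mulN1r.
  rewrite lerBlDr -lerBlDl; apply: bernoulli_powR => //.
  by rewrite invr_ge0 ler0n invf_le1// ler1n.
have Hl : H <= \sum_(k < n) (k.+1%:R `^ (- p^-1)) ^+ l.
  apply: ler_sum => k _.
  rewrite -powR_mulrn ?powR_ge0// -powRrM -[k.+1%:R^-1]powR_inv1//.
  apply: ler_powR; first by rewrite ler1n.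
  by rewrite mulNr lerN2 mulrC ler_pdivrMr// mul1r.
apply: (@lt_le_trans _ _ (a * H)); last by rewrite ler_wpM2l// ltW.
apply: (@le_lt_trans _ _ (b * z `^ (l%:R / q))).
  rewrite ler_wpM2l// -powR_mulrn ?powR_ge0// -powRrM mulrC.
  by apply: ge0_ler_powR; rewrite ?nnegrE ?lorentz_sum_ge0 ?divr_ge0 ?(ltW z0) ?(ltW q0).
rewrite ltr_pdivrMr// in bz.
rewrite -(ltr_pM2l W0) mulrA [W%:R * (a * H)]mulrCA -/z.
have -> : a * z = z `^ (1 - l%:R / q) * a * z `^ (l%:R / q).
  rewrite mulrAC -powRD ?subrK ?powRr1 ?(ltW z0)// ?gt_eqF ?implybT//.
  by rewrite mulrC.
by rewrite ltr_pM2r ?powR_gt0.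
Qed.

Theorem lorentz_coordinates_not_UH_smooth (X : normedModType R) (r : R) : p != q ->
  Num.min p q < r -> lorentz_coordinates p q X -> ~ UH_smooth X r.
Proof.
move=> pq mr coords.
have [pltq|qltp|pq'] := ltgtP p q; last by move: pq; rewrite pq' eqxx.
  have pr : p < r by move: mr; rewrite min_l// ltW.
  have [c c0 rich] := rich_lp p0 q0 coords.
  have mp := truncn_itv (ltW p0).
  apply: (not_UH_smooth p0 c0 pr mp _ _ _ rich) => [k|n|l a b /andP[l0 lm]].
  - rewrite powR_gt0//= powRN invf_le1 ?powR_gt0//.
    rewrite -[leLHS](powRr0 k.+1%:R); apply: ler_powR; first by rewrite ler1n.
    by rewrite invr_ge0 ltW.
  - exact: powR_ge0.
  - apply: lp_growth => //; rewrite (le_trans _ (andP mp).1)// ler_nat//.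
have qr : q < r by move: mr; rewrite min_r// ltW.
have [c c0 rich] := rich_lq p0 q0 coords.
have mq := truncn_itv (ltW q0).
apply: (not_UH_smooth q0 c0 qr mq _ _ _ rich) => [k|n|l a b /andP[l0 lm]].
- by rewrite ltr01 lexx.
- exact: powR_ge0.
- apply: lq_growth => //; rewrite (le_lt_trans _ qltp)// (le_trans _ (andP mq).1)// ler_nat//.
Qed.

End LorentzCoordinatesNotSmooth.

(** * Lorentz sequence and function spaces *)

Lemma lee_poweR (R : realType) (r : R) (x y : \bar R) : 0 < r -> (0 <= x)%E -> (x <= y)%E ->
  (x `^ r <= y `^ r)%E.
Proof.
move=> r0 x0 xy; apply: gt0_ler_poweR => //; first exact: ltW.
  by rewrite in_itv/= x0 leey.
by rewrite in_itv/= leey (le_trans x0).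
Qed.

Section Rearrangement.
Context (R : realType) (T : Type) (mu : set T -> \bar R) (I : set T).

Lemma rearr_ge0 f s : (0 <= rearr mu I f s)%E.
Proof. by apply: le_ereal_inf_tmp => _ [l [l0 _] <-]; rewrite lee_fin. Qed.

Variables (f : T -> R) (x : nat -> R) (D : nat) (v : R).
Hypothesis v0 : 0 <= v.
Hypothesis levels : forall l, 0 <= l ->
  mu (I `&` [set y | l < `|f y|]) = ((count (fun a => (l < `|x a|)%R) (iota 0 D))%:R * v)%:E.

Lemma rearr_le_count b k s : 0 <= b -> (count (fun a => (b < `|x a|)%R) (iota 0 D) <= k)%N ->
  k%:R * v <= s -> (rearr mu I f s <= b%:E)%E.
Proof.
move=> b0 bk ks; apply: ereal_inf_lbound; exists b => //; split=> //.
by rewrite levels// lee_fin (le_trans _ ks)// ler_wpM2r// ler_nat.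
Qed.

(** A level [l < b] admissible in the infimum would have a superlevel set of measure at least
    [(k + 1) * v > s]. *)
Lemma rearr_ge_count b k s : (k < count (fun a => (b <= `|x a|)%R) (iota 0 D))%N ->
  s < k.+1%:R * v -> (b%:E <= rearr mu I f s)%E.
Proof.
move=> kb sk; apply: le_ereal_inf_tmp => _ [l [l0 ls] <-].
rewrite lee_fin leNgt; apply/negP => lb; move: ls; rewrite levels// lee_fin leNgt => /negP; apply.
rewrite (lt_le_trans sk)// ler_wpM2r// ler_nat (leq_trans kb)//.
by apply: sub_count => a /=; exact: lt_le_trans.
Qed.

End Rearrangement.

Section Renormings.
Context (R : realType) (p q : R).
Hypotheses (p0 : 0 < p) (q0 : 0 < q).

(** Reduces each space to an embedding [F] of [l_{p,q}^D] that is exact for the functional [N] up to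
    a scalar [kappa]; the renorming only costs the constants [c] and [C]. *)
Lemma renorming_lorentz_coordinates (T : Type) (S : set (T -> R))
    (N : (T -> R) -> \bar R) (X : normedModType R) :
  renorming_of S N X ->
  (forall D, (0 < D)%N -> exists F : (nat -> R) -> T -> R, exists2 kappa : R, 0 < kappa &
    [/\ forall (b : R) (x y : nat -> R) s, F (fun a => b * x a + y a) s = b * F x s + F y s,
      forall x, (N (F x) < +oo)%E -> S (F x),
      forall (x t : nat -> R) (n : nat), (forall k, (k < n)%N -> 0 <= t k) ->
        (forall k, (k < n)%N -> (count (fun a => (t k < `|x a|)%R) (iota 0 D) <= k)%N) ->
        (count (fun a => (x a != 0)%R) (iota 0 D) <= n)%N ->
        (kappa%:E * N (F x) <= (lorentz_sum p q n t `^ q^-1)%:E)%E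
    & forall (x t : nat -> R) (n : nat), (forall k, (k < n)%N -> 0 <= t k) ->
        (forall k, (k < n)%N -> (k < count (fun a => (t k <= `|x a|)%R) (iota 0 D))%N) ->
        ((lorentz_sum p q n t `^ q^-1)%:E <= kappa%:E * N (F x))%E ]) ->
  lorentz_coordinates p q X.
Proof.
move=> [J [Jl Jsurj [c [C [c0 C0 JN]]]]] coords; exists c, C; split=> // D.
have [D0|/coords[F [kappa k0 [Fl FS FU FL]]]] := posnP D.
  exists (fun=> 0); split=> [b x y|x t n _ _ _|x t n _ tn].
  - by rewrite scaler0 addr0.
  - by rewrite normr0 mulr_ge0 ?powR_ge0// ltW.
  - case: n tn => [_|n /(_ 0%N isT)]; last by rewrite D0.
    by rewrite /lorentz_sum big_ord0 powR0 ?mulr0 ?normr0// invr_neq0// gt_eqF.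
(* Membership in [S] follows from the upper estimate with the crude constant bound
   [\sum_(a < D) |x a|]. *)
have SF x : S (F x).
  apply: FS; have : (kappa%:E * N (F x) < +oo)%E.
    apply: (@le_lt_trans _ _ _ _ _ _ (ltry _)).
    apply: (FU x (fun=> \sum_(a < D) `|x a|) D) => [k _|k _|].
    - exact: sumr_ge0.
    - rewrite (@leq_trans 0%N)// leqn0 eqn0Ngt -has_count -all_predC; apply/allP => a.
      rewrite mem_iota/= add0n => aD; rewrite -leNgt.
      by rewrite (bigD1 (Ordinal aD))//= lerDl sumr_ge0.
    - by rewrite (leq_trans (count_size _ _))// size_iota.
  move=> h; rewrite ltey; apply/eqP => Ny; move: h.
  by rewrite Ny gt0_muley ?lte_fin// ltxx.
have JE x : `|kappa *: J (F x)| = kappa * `|J (F x)| by rewrite normrZ gtr0_norm.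
exists (fun x => kappa *: J (F x)); split=> [b x y|x t n t0 tn xn|x t n t0 tn].
- have -> : F (fun a => b * x a + y a) = (fun s => b * F x s + F y s).
    by apply/funext => s; rewrite Fl.
  by rewrite Jl// scalerDr !scalerA [kappa * b]mulrC.
- have [_ JC] := JN _ (SF x); rewrite JE -lee_fin !EFinM.
  apply: (@le_trans _ _ (kappa%:E * (C%:E * N (F x)))%E).
    by rewrite lee_wpmul2l// lee_fin ltW.
  by rewrite muleCA lee_wpmul2l ?lee_fin ?(ltW C0)//; exact: FU.
- have [Jc _] := JN _ (SF x); rewrite JE -lee_fin !EFinM.
  apply: (@le_trans _ _ (kappa%:E * (c%:E * N (F x)))%E).
    by rewrite muleCA lee_wpmul2l ?lee_fin ?(ltW c0)//; exact: FL.
  by rewrite lee_wpmul2l// lee_fin ltW.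
Qed.

Lemma counting_filter (P : pred nat) D :
  counting [set a | (a < D)%N && P a] = (count P (iota 0 D))%:R%:E :> \bar R.
Proof.
have -> : [set a | (a < D)%N && P a] = [set` [fset a in [seq a <- iota 0 D | P a]]%fset].
  by apply/seteqP; split=> a /=; rewrite !inE/= mem_filter mem_iota/= add0n andbC.
rewrite /counting asboolT; last exact: finite_fset.
by rewrite set_fsetK card_fseq undup_id ?filter_uniq ?iota_uniq// size_filter.
Qed.

Lemma lorentz_seq_coordinates (X : normedModType R) :
  is_lorentz_seq_space p q X -> lorentz_coordinates p q X.
Proof.
move/renorming_lorentz_coordinates; apply => D D0.
pose F (x : nat -> R) a := if (a < D)%N then x a else 0.
have levels x (l : R) : 0 <= l -> counting ([set: nat] `&` [set y | l < `|F x y|]) =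
    ((count (fun a => (l < `|x a|)%R) (iota 0 D))%:R * 1)%:E :> \bar R.
  move=> l0; rewrite mulr1 setTI -(counting_filter (fun a => (l < `|x a|)%R)); congr counting.
  by apply/seteqP; split=> a /=; rewrite /F; case: ifP => //= _; rewrite normr0 ltNge l0.
have u0 x k : (0 <= rearr counting [set: nat] (F x) k%:R `^ q
    * (k.+1%:R `^ (q / p) - k%:R `^ (q / p))%R%:E)%E.
  by rewrite mule_ge0 ?poweR_ge0// lee_fin lorentz_wt_ge0.
exists F, 1 => //; split.
- by move=> b x y s; rewrite /F; case: ifP => // _; rewrite mulr0 addr0.
- by [].
- move=> x t n t0 tn xn; rewrite mul1e -poweR_EFin.
  apply: lee_poweR; [by rewrite invr_gt0|by apply: nneseries_ge0 => k _ _; exact: u0|].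
  apply: lime_le; first by apply: is_cvg_nneseries => k _ _; exact: u0.
  apply: nearW => m.
  (* Enlarge the partial sum to at least [n] terms; those past [n] vanish, as [x] has at most [n]
     nonzero coordinates. *)
  have h := @lee_sum_nneg_natr _ _ xpredT 0%N (fun k _ _ => u0 x k) _ _ (leq_addl n m).
  apply: (le_trans h) => {h}.
  rewrite (big_cat_nat _ (n := n)) ?leq_addr//= [X in (_ + X)%E]big1_seq ?adde0; last first.
    move=> k; rewrite mem_index_iota => /andP[_ /andP[nk _]].
    suff -> : rearr counting [set: nat] (F x) k%:R = 0%E by rewrite poweR0r ?mul0e// gt_eqF.
    apply/eqP; rewrite eq_le rearr_ge0 andbT.
    apply: (rearr_le_count (k := k) ler01 (levels x)) => //; last by rewrite mulr1.
    by rewrite (leq_trans _ nk)// (leq_trans _ xn)//; apply: sub_count => a /=; rewrite normr_gt0.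
  rewrite big_mkord /lorentz_sum -sumEFin; apply: lee_sum => k _.
  rewrite EFinM -poweR_EFin lee_wpmul2r ?lee_fin ?lorentz_wt_ge0//.
  apply: lee_poweR => //; first exact: rearr_ge0.
  by apply: (rearr_le_count ler01 (levels x) (t0 _ (ltn_ord k)) (tn _ (ltn_ord k))); rewrite mulr1.
move=> x t n t0 tn; rewrite mul1e -poweR_EFin.
apply: lee_poweR; [by rewrite invr_gt0|by rewrite lee_fin lorentz_sum_ge0|].
apply: (le_trans _ (nneseries_lim_ge n (fun k _ _ => u0 x k))).
rewrite big_mkord /lorentz_sum -sumEFin; apply: lee_sum => k _.
rewrite EFinM -poweR_EFin lee_wpmul2r ?lee_fin ?lorentz_wt_ge0//.
apply: lee_poweR => //; first by rewrite lee_fin t0.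
by apply: (rearr_ge_count ler01 (levels x) (tn _ (ltn_ord k))); rewrite mulr1 ltr_nat.
Qed.

End Renormings.

(** * The measure [d(t ^ w)] of intervals *)

Section PowerIntegral.
Context (R : realType).
Local Notation mu := (@lebesgue_measure R).

(** The integral of a nonnegative function is a supremum over simple functions below it, hence
    monotone. This handles integrands containing [rearr] without establishing their
    measurability. *)
Lemma ge0_le_integral_nonmeasurable (I : set R) (f g : R -> \bar R) :
  (forall x, I x -> 0 <= f x)%E -> (forall x, I x -> f x <= g x)%E ->
  (\int[mu]_(x in I) f x <= \int[mu]_(x in I) g x)%E.
Proof.
move=> f0 fg; rewrite !ge0_integralE//; last by move=> x Ix; rewrite (le_trans (f0 x Ix)) ?fg.
apply: ereal_sup_le => _ [h hf <-]; exists h => // x.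
apply: (le_trans (hf x)); rewrite /patch; case: ifPn => // xI.
by apply: fg; exact: set_mem.
Qed.

Variables (w : R) (w0 : 0 < w).
Let g (t : R) : \bar R := (w * t `^ (w - 1))%R%:E.

Lemma measurable_powR_density (A : set R) : measurable_fun A g.
Proof.
apply/measurable_EFinP; apply: measurable_funTS.
by apply: measurable_funM => //; exact: measurable_powR.
Qed.

Lemma powR_density_ge0 t : (0 <= g t)%E.
Proof. by rewrite lee_fin mulr_ge0 ?powR_ge0// ltW. Qed.

Let integral_powR_gt0 (a b : R) : 0 < a -> a < b ->
  (\int[mu]_(t in `[a, b[) g t = (b `^ w - a `^ w)%:E)%E.
Proof.
move=> a0 ab; rewrite integral_itv_bndo_bndc; last exact: measurable_powR_density.
have cont (e x : R) : 0 < x -> (fun t : R => t `^ e) @ x --> x `^ e.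
  move=> x0; have : derivable (fun t : R => t `^ e) x 1.
    by apply: derivable_powR; rewrite in_itv/= x0.
  by move/derivable1_diffP/differentiable_continuous.
rewrite /g (@continuous_FTC2 _ (fun t => w * t `^ (w - 1)) (fun t => t `^ w))//.
- apply: continuous_in_subspaceT => x /set_mem; rewrite /= in_itv/= => /andP[ax _].
  by apply: cvgM; [exact: cvg_cst|apply: cont; exact: lt_le_trans ax].
- have b0 : 0 < b := lt_trans a0 ab.
  split; last 2 first.
  + by apply: cvg_at_right_filter; exact: cont.
  + by apply: cvg_at_left_filter; exact: cont.
  move=> x; rewrite in_itv/= => /andP[ax _].
  by apply: derivable_powR; rewrite in_itv/= (lt_trans a0).
- move=> x; rewrite in_itv/= => /andP[ax _].
  by rewrite powR_derive1// in_itv/= (lt_trans a0).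
Qed.

(** For [w < 1] the density blows up at 0, so the fundamental theorem of calculus is used on [[c n,
    b[] only, and these intervals exhaust []0, b[]. *)
Lemma integral_powR (a b : R) : 0 <= a -> a < b ->
  (\int[mu]_(t in `[a, b[) g t = (b `^ w - a `^ w)%:E)%E.
Proof.
rewrite le_eqVlt => /predU1P[<-|]; last exact: integral_powR_gt0.
move=> b0; rewrite powR0 ?gt_eqF// subr0.
pose c n : R := b / n.+2%:R.
have c0 n : 0 < c n by rewrite divr_gt0.
have cb n : c n < b by rewrite /c ltr_pdivrMr// ltr_pMr// ltr1n.
have In n : (\int[mu]_(t in `[c n, b[) g t = (b `^ w - c n `^ w)%:E)%E by exact: integral_powR_gt0.
have -> : (\int[mu]_(t in `[0%R, b[) g t = \int[mu]_(t in `]0%R, b[) g t)%E.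
  by rewrite -integral_itv_obnd_cbnd//; exact: measurable_powR_density.
have U : `]0, b[%classic = \bigcup_n `[c n, b[%classic.
  apply/seteqP; split=> x /=; rewrite in_itv/=.
    move=> /andP[x0 xb]; exists (Num.Def.archi_bound (b / x)) => //=.
    rewrite in_itv/= xb andbT /c ler_pdivrMr// mulrC -ler_pdivrMr//.
    apply: ltW; apply: lt_le_trans (archi_boundP _) _; first by rewrite divr_ge0// ltW.
    by rewrite ler_nat -addn2 leq_addr.
  by move=> [n _] /=; rewrite in_itv/= => /andP[cx ->]; rewrite (lt_le_trans (c0 n)).
apply/eqP; rewrite eq_le; apply/andP; split; last first.
  apply/lee_addgt0Pr => e e0.
  (* This [n] makes the missing mass [c n ^ w] at most [e]. *)
  have [|n [n0 _ bn]] := exists_large_powR w0 w0 (lexx 0) (b := b `^ w / e).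
    by rewrite divr_ge0 ?powR_ge0 ?ltW.
  apply: (@le_trans _ _ (\int[mu]_(t in `[c n, b[) g t + e%:E)%E); last first.
    rewrite leeD2r// U; apply: ge0_subset_integral => //.
    - by apply: bigcup_measurable => k _; exact: measurable_itv.
    - exact: measurable_powR_density.
    - by move=> x _; exact: powR_density_ge0.
    - by move=> x xI; exists n.
  rewrite In lee_fin addrAC -addrA lerDl subr_ge0 /c powRM ?invr_ge0 ?(ltW b0)//.
  rewrite ltr_pdivrMr// mulrC -ltr_pdivrMr ?powR_gt0 ?ltr0n// in bn.
  rewrite -powR_inv1// -powRrM mulN1r powRN (le_trans _ (ltW bn))//.
  rewrite ler_wpM2l ?powR_ge0// lef_pV2 ?posrE ?powR_gt0 ?ltr0n//.
  by apply: ge0_ler_powR; rewrite ?nnegrE ?(ltW w0)// ler_nat -addn2 leq_addr.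
have nd : nondecreasing_seq (fun n => `[c n, b[%classic).
  move=> m n mn; rewrite subsetEset => x /=; rewrite !in_itv/= => /andP[cx ->].
  rewrite andbT (le_trans _ cx)// /c ler_pM2l// lef_pV2 ?posrE// ler_nat !ltnS.
  exact: mn.
have cv : (\int[mu]_(t in `[c n, b[) g t @[n --> \oo] -->
    \int[mu]_(t in \bigcup_n `[c n, b[%classic) g t)%E.
  apply: ge0_nondecreasing_set_cvg_integral => //.
  - by move=> n; exact: measurable_powR_density.
  - by move=> n x _; exact: powR_density_ge0.
rewrite U; apply: (cvge_to_le cv); apply: nearW => n.
by rewrite [leLHS]In lee_fin gerBl powR_ge0.
Qed.

End PowerIntegral.

(** * Step functions in [L_{p,q}] *)

Section LorentzFunctionSpaces.
Context (R : realType) (p q : R).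
Hypotheses (p0 : 0 < p) (q0 : 0 < q).
Local Notation mu := (@lebesgue_measure R).

Let w0 : 0 < q / p. Proof. by rewrite divr_gt0. Qed.
Let g (t : R) : \bar R := (q / p * t `^ (q / p - 1))%R%:E.

Variables (I : set R).
Hypotheses (mI : measurable I) (I01 : `[0, 1]%classic `<=` I) (I0 : I `<=` `[0, +oo[%classic).

Section StepFunctions.
Variables (D : nat) (D0 : (0 < D)%N).

Let DR : 0 < D%:R :> R. Proof. by rewrite ltr0n. Qed.

(** All [k] are allowed: the cells with [k < D] carry step functions, while all cells together
    partition the half-line on which rearrangements live. *)
Definition mesh (k : nat) : set R := `[k%:R / D%:R, k.+1%:R / D%:R[%classic.

Lemma meshP k s : mesh k s <-> k%:R <= s * D%:R < k.+1%:R.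
Proof. by rewrite /mesh /= in_itv/= ler_pdivrMr// ltr_pdivlMr. Qed.

Lemma mesh_inj j k s : mesh j s -> mesh k s -> j = k.
Proof.
move=> /meshP/andP[js sj] /meshP/andP[ks sk].
have := le_lt_trans js sk; have := le_lt_trans ks sj.
by rewrite !ltr_nat !ltnS => kj jk; apply/eqP; rewrite eqn_leq kj jk.
Qed.

Lemma mesh_cover s : 0 <= s -> mesh (Num.truncn (s * D%:R)) s.
Proof. by move=> s0; apply/meshP/truncn_itv; rewrite mulr_ge0. Qed.

Lemma measurable_mesh k : measurable (mesh k).
Proof. exact: measurable_itv. Qed.

Lemma sub_mesh k : (k < D)%N -> mesh k `<=` I.
Proof.
move=> kD s /=; rewrite /mesh/= in_itv/= => /andP[ks sk]; apply: I01.
rewrite /= in_itv/= (le_trans _ ks) ?divr_ge0//= (ltW (lt_le_trans sk _))//.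
by rewrite ler_pdivrMr// mul1r ler_nat.
Qed.

Lemma integral_mesh k :
  (\int[mu]_(s in mesh k) g s = (D%:R `^ (- (q / p)) * lorentz_wt p q k)%:E)%E.
Proof.
rewrite integral_powR ?divr_ge0//; last by rewrite ltr_pM2r ?invr_gt0// ltr_nat.
by rewrite !powRM ?invr_ge0// -[D%:R^-1]powR_inv1// -powRrM mulN1r -mulrBl mulrC.
Qed.

(** The Lorentz integrand of a function whose rearrangement equals [t k] on the [k]-th cell,
    [k < n], and 0 beyond. *)
Let h (t : nat -> R) (n : nat) (s : R) : \bar R :=
  (\sum_(k < n) (t k `^ q)%:E * (g \_ (mesh k)) s)%E.

Let g0 s : (0 <= g s)%E. Proof. exact: powR_density_ge0. Qed.

Let gm0 k s : (0 <= (g \_ (mesh k)) s)%E.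
Proof. by rewrite /patch; case: ifPn. Qed.

Let h_mesh t n k s : (k < n)%N -> mesh k s -> (h t n s = (t k `^ q)%:E * g s)%E.
Proof.
move=> kn ks; rewrite /h (bigD1 (Ordinal kn))//= big1 ?adde0.
  by rewrite /patch mem_set.
move=> j jk; rewrite /patch memNset ?mule0// => js.
by move: jk; rewrite -val_eqE/= (mesh_inj js ks) eqxx.
Qed.

Let h_ge0 t n s : (0 <= h t n s)%E.
Proof. by apply: sume_ge0 => k _; rewrite mule_ge0 ?lee_fin ?powR_ge0. Qed.

Let integral_h t n :
  (\int[mu]_(s in I) h t n s = \sum_(k < n) (t k `^ q)%:E * \int[mu]_(s in I `&` mesh k) g s)%E.
Proof.
have mgk k : measurable_fun I (g \_ (mesh k)).
  apply: measurable_funTS.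
  have mg : measurable_fun (mesh k) g := @measurable_powR_density R (q / p) (mesh k).
  exact: ((measurable_restrictT g (measurable_mesh k)).1 mg).
rewrite ge0_integral_sum//; last 2 first.
- by move=> k; apply: measurable_funeM; exact: mgk.
- by move=> k s _; rewrite mule_ge0 ?lee_fin ?powR_ge0.
apply: eq_bigr => k _; rewrite integral_mkcondr ge0_integralZl_EFin ?powR_ge0//.
exact: mgk.
Qed.

(** Refining [[0, 1]] instead of extending the domain puts [l_{p,q}^D] into both function spaces at
    once; the factor [D ^ (1 / p)] makes up for the cell length. *)
Definition step_function (x : nat -> R) (s : R) : R := \sum_(a < D) x a * \1_(mesh a) s.

Lemma step_function_mesh x a s : (a < D)%N -> mesh a s -> step_function x s = x a.
Proof.
move=> aD am; rewrite /step_function (bigD1 (Ordinal aD))//= indicE mem_set// mulr1 big1 ?addr0//.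
move=> j ja; rewrite indicE memNset ?mulr0// => jm.
by move: ja; rewrite -val_eqE/= (mesh_inj jm am) eqxx.
Qed.

Lemma step_function_neq0 x s : step_function x s != 0 -> exists2 a, (a < D)%N & mesh a s.
Proof.
move=> xs; apply: contrapT => no; move: xs; rewrite /step_function big1 ?eqxx// => a _.
by rewrite indicE memNset ?mulr0// => am; apply: no; exists a.
Qed.

Lemma measurable_step_function x : measurable_fun I (step_function x).
Proof.
apply: measurable_sum => a; apply: measurable_funM => //.
by apply: measurable_indic; exact: measurable_mesh.
Qed.

Lemma step_function_levels x l : 0 <= l ->
  mu (I `&` [set s | l < `|step_function x s|]) =
  ((count (fun a => (l < `|x a|)%R) (iota 0 D))%:R * D%:R^-1)%:E.
Proof.
move=> l0.
have -> : I `&` [set s | l < `|step_function x s|] =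
    \big[setU/set0]_(a < D | l < `|x a|) mesh a.
  rewrite -(bigcup_pred [pred a : 'I_D | l < `|x a|]); apply/seteqP; split=> s /=.
    move=> [_ ls].
    have [|a aD am] := @step_function_neq0 x s; first by rewrite -normr_gt0 (le_lt_trans l0).
    exists (Ordinal aD) => //=; rewrite (step_function_mesh x aD am) in ls.
    by rewrite inE.
  move=> [a /=]; rewrite inE => la am; split; first exact: (sub_mesh (ltn_ord a)).
  by rewrite (step_function_mesh x (ltn_ord a) am).
have muE k : mu (mesh k) = (D%:R^-1)%:E.
  rewrite /mesh lebesgue_measure_itv/= lte_fin ltr_pM2r ?invr_gt0// ltr_nat ltnSn.
  by rewrite -EFinB -mulrBl -natrB// subSnn mul1r.
rewrite measure_bigsetU_ord; last 2 first.
- by move=> a; exact: measurable_mesh.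
- apply/trivIsetP => a b _ _ ab; apply/seteqP; split=> // s [as_ bs].
  by move: ab; rewrite -val_eqE/= (mesh_inj as_ bs) eqxx.
rewrite (eq_bigr (fun=> (D%:R^-1)%:E)) => [|a _]; last exact: muE.
rewrite sumEFin.
rewrite -(big_mkord (fun a => l < `|x a|) (fun=> D%:R^-1)) /index_iota subn0.
by rewrite big_const_seq iter_addr addr0 mulr_natl.
Qed.

Section Bounds.
Variables (x t : nat -> R) (n : nat).
Hypothesis t0 : forall k, (k < n)%N -> 0 <= t k.

Let v0 : 0 <= D%:R^-1 :> R. Proof. by rewrite invr_ge0. Qed.

Let scale : ((D%:R `^ p^-1)%:E * (D%:R `^ (- (q / p)) * lorentz_sum p q n t)%:E `^ q^-1
  = (lorentz_sum p q n t `^ q^-1)%:E)%E.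
Proof.
rewrite poweR_EFin -EFinM powRM ?powR_ge0 ?lorentz_sum_ge0//.
rewrite -powRrM mulrA -powRD; last by rewrite (gt_eqF DR) implybT.
have -> : p^-1 + - (q / p) / q = 0 by field; rewrite !gt_eqF.
by rewrite powRr0 mul1r.
Qed.

Lemma step_function_norm_le :
  (forall k, (k < n)%N -> (count (fun a => (t k < `|x a|)%R) (iota 0 D) <= k)%N) ->
  (count (fun a => (x a != 0)%R) (iota 0 D) <= n)%N ->
  ((D%:R `^ p^-1)%:E * lorentz_fun_norm p q I (step_function x)
    <= (lorentz_sum p q n t `^ q^-1)%:E)%E.
Proof.
move=> tn xn; rewrite -scale; apply: lee_wpmul2l; first by rewrite lee_fin powR_ge0.
apply: lee_poweR; first by rewrite invr_gt0.
  by apply: integral_ge0 => s _; rewrite mule_ge0 ?poweR_ge0//; exact: g0.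
have -> : ((D%:R `^ (- (q / p)) * lorentz_sum p q n t)%:E =
    \sum_(k < n) (t k `^ q)%:E * \int[mu]_(s in mesh k) g s)%E.
  rewrite /lorentz_sum mulr_sumr -sumEFin; apply: eq_bigr => k _.
  by rewrite integral_mesh -EFinM mulrCA.
apply: (@le_trans _ _ (\int[mu]_(s in I) h t n s)%E).
  apply: ge0_le_integral_nonmeasurable => s Is.
    by rewrite mule_ge0 ?poweR_ge0//; exact: g0.
  have s0 : 0 <= s by have := I0 Is; rewrite /= in_itv/= andbT.
  have := mesh_cover s0; set k := Num.truncn _ => ks.
  have [/andP[ks1 ks2]] := (meshP k s).1 ks.
  have kv : k%:R * D%:R^-1 <= s by rewrite ler_pdivrMr.
  have [kn|nk] := ltnP k n.
    rewrite (h_mesh t kn ks) -poweR_EFin; apply: lee_wpmul2r; first exact: g0.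
    apply: lee_poweR => //; first exact: rearr_ge0.
    exact: (rearr_le_count (k := k) v0 (step_function_levels x) (t0 kn) (tn k kn)).
  (* Past the [n]-th cell, the measure of the support is already exhausted. *)
  suff -> : rearr mu I (step_function x) s = 0%E by rewrite poweR0r ?gt_eqF// mul0e.
  apply/eqP; rewrite eq_le rearr_ge0 andbT.
  apply: (rearr_le_count (k := k) v0 (step_function_levels x)) => //.
  by rewrite (leq_trans _ nk)// (leq_trans _ xn)//; apply: sub_count => a /=; rewrite normr_gt0.
rewrite integral_h; apply: lee_sum => k _; rewrite lee_wpmul2l ?lee_fin ?powR_ge0//.
apply: ge0_subset_integral => //.
- by apply: measurableI => //; exact: measurable_mesh.
- exact: measurable_mesh.
- exact: measurable_powR_density.
Qed.

Lemma step_function_norm_ge :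
  (forall k, (k < n)%N -> (k < count (fun a => (t k <= `|x a|)%R) (iota 0 D))%N) ->
  ((lorentz_sum p q n t `^ q^-1)%:E
    <= (D%:R `^ p^-1)%:E * lorentz_fun_norm p q I (step_function x))%E.
Proof.
move=> tn; rewrite -scale; apply: lee_wpmul2l; first by rewrite lee_fin powR_ge0.
apply: lee_poweR; first by rewrite invr_gt0.
  by rewrite lee_fin mulr_ge0 ?powR_ge0// lorentz_sum_ge0.
(* The count cannot exceed [D], so all cells involved lie in [[0, 1]] and hence in [I]. *)
have nD k : (k < n)%N -> (k < D)%N.
  by move=> /tn kc; rewrite (leq_trans kc)// (leq_trans (count_size _ _))// size_iota.
have -> : ((D%:R `^ (- (q / p)) * lorentz_sum p q n t)%:E = \int[mu]_(s in I) h t n s)%E.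
  rewrite integral_h /lorentz_sum mulr_sumr -sumEFin; apply: eq_bigr => k _.
  by rewrite (setIidr (sub_mesh (nD k (ltn_ord k)))) integral_mesh -EFinM mulrCA.
apply: ge0_le_integral_nonmeasurable => s Is; first exact: h_ge0.
have s0 : 0 <= s by have := I0 Is; rewrite /= in_itv/= andbT.
have [[k kn ks]|no] := pselect (exists2 k, (k < n)%N & mesh k s).
  rewrite (h_mesh t kn ks) -poweR_EFin; apply: lee_wpmul2r; first exact: g0.
  apply: lee_poweR => //; first by rewrite lee_fin t0.
  apply: (rearr_ge_count v0 (step_function_levels x) (tn k kn)).
  by have [/andP[_ sk]] := (meshP k s).1 ks; rewrite ltr_pdivlMr.
have -> : h t n s = 0%E; last by rewrite mule_ge0 ?poweR_ge0//; exact: g0.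
apply: big1 => k _; rewrite /patch memNset ?mule0// => ks.
by apply: no; exists k.
Qed.

End Bounds.
End StepFunctions.

Lemma lorentz_fun_coordinates (X : normedModType R) :
  is_lorentz_fun_space p q I X -> lorentz_coordinates p q X.
Proof.
move/(renorming_lorentz_coordinates q0); apply => D D0.
exists (step_function D), (D%:R `^ p^-1); first by rewrite powR_gt0// ltr0n.
split.
- move=> b x y s; rewrite /step_function mulr_sumr -big_split/=.
  by apply: eq_bigr => a _; rewrite mulrDl mulrA.
- by move=> x xfin; split=> //; exact: measurable_step_function.
- by move=> x t n t0; exact: step_function_norm_le.
- by move=> x t n t0; exact: step_function_norm_ge.
Qed.

End LorentzFunctionSpaces.

Theorem proposition8 (R : realType) (p q : R) (hp : 1 < p) (hq : 1 < q)
    (hpq : p != q) :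
  ((forall (r : R) (X : completeNormedModType R),
      Num.min p q < r -> is_lorentz_seq_space p q X -> ~ UH_smooth X r)
   /\
   (forall (r : R) (X : completeNormedModType R),
      Num.min p q < r -> is_lorentz_fun_space p q `[0, +oo[ X ->
      ~ UH_smooth X r))
  /\
  (forall (r : R) (X : completeNormedModType R),
      q < r -> is_lorentz_fun_space p q `[0, 1] X -> ~ UH_smooth X r).
Proof.
have p0 : 0 < p by exact: lt_trans hp.
have q0 : 0 < q by exact: lt_trans hq.
split; [split|] => r X rpq HX.
- apply: (lorentz_coordinates_not_UH_smooth hp hq hpq rpq).
  exact: lorentz_seq_coordinates HX.
- apply: (lorentz_coordinates_not_UH_smooth hp hq hpq rpq).
  apply: (lorentz_fun_coordinates p0 q0 _ _ _ HX) => // x /=.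
  by rewrite !in_itv/= andbT => /andP[].
(* On [[0, 1]] the same obstruction is available, and [q < r] implies [min p q < r]. *)
- apply: (lorentz_coordinates_not_UH_smooth hp hq hpq _ (r := r)).
    by rewrite gt_min rpq orbT.
  apply: (lorentz_fun_coordinates p0 q0 _ _ _ HX) => // x /=.
  by rewrite !in_itv/= andbT => /andP[].
Qed.
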